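(* Let $\Gamma$ be a distance-regular graph with diameter $D\geq 3$, vertex set $X$, Bose–Mesner algebra $\mathbf{M}$, and fix $x\in X$ with Terwilliger algebra $\mathbf{T}=\mathbf{T}(x)$. Let $v$ be a nonzero vector in $E^*_1V$ orthogonal to $s_1$, and suppose $v$ is contained in a thin irreducible $\mathbf{T}$-module $W$ with endpoint $1$ (equivalently, $(\mathbf{M};v):=\{P\in\mathbf{M}\mid Pv\in E^*_DV\}$ has dimension at least $2$). Let $\eta$ be the local eigenvalue of $W$, and let $E$ be a pseudo primitive idempotent for $\widetilde\eta$. Then $J,E$ form a basis for $(\mathbf{M};v)$.
   Context: $\Gamma=(X,R)$ is a finite, undirected, connected graph without loops or multiple edges, with path-length distance $\partial$ and diameter $D$; it is distance-regular, i.e. for $y,z$ with $\partial(y,z)=h$ the number $p^h_{ij}=|\{w:\partial(y,w)=i,\partial(w,z)=j\}|$ depends only on $h,i,j$. Write $b_1=p^1_{1,2}$. $A_i$ ($0\le i\le D$) is the $i$th distance matrix ($yz$-entry $1$ if $\partial(y,z)=i$, else $0$), $A=A_1$, $J$ is the all-ones matrix, and $\mathbf{M}$ is the algebra generated by $A$ (basis $A_0,\dots,A_D$). $V=\mathbb{C}^X$ with inner product $\langle u,w\rangle=u^t\overline w$, $\hat y$ the standard basis. $E^*_i$ is the diagonal matrix with $yy$-entry $1$ if $\partial(x,y)=i$, else $0$; $s_i=\sum_{\partial(x,y)=i}\hat y$. $\mathbf{T}$ is the algebra generated by $A,E^*_0,\dots,E^*_D$; $\mathbf{T}$-modules, irreducibility,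 endpoint ($\min\{i:E^*_iW\ne0\}$) and thinness ($\dim E^*_iW\le1$ for all $i$) are as usual. For a thin irreducible $\mathbf{T}$-module $W$ with endpoint $1$, $E^*_1W$ is a one-dimensional eigenspace of $E^*_1AE^*_1$; its eigenvalue $\eta$ is the local eigenvalue of $W$. For $\theta\in\mathbb{C}$, $\mathbf{M}(\theta)=\{Y\in\mathbf{M}:(A-\theta I)Y\in\mathbb{C}A_D\}$, and $\mathbf{M}(\infty)=\mathbb{C}A_D$; a pseudo primitive idempotent for $\theta\in\mathbb{C}\cup\{\infty\}$ is a nonzero element of $\mathbf{M}(\theta)$. The map $\eta\mapsto\widetilde\eta$ on $\mathbb{C}\cup\{\infty\}$ is: $\widetilde\eta=\infty$ if $\eta=-1$; $\widetilde\eta=-1$ if $\eta=\infty$; $\widetilde\eta=-1-\frac{b_1}{1+\eta}$ otherwise. *)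

(* Defs.v *)
From HB Require Import structures.
From mathcomp Require Import all_boot all_order all_algebra.
From mathcomp Require Import reals complex.

Set Implicit Arguments.
Unset Strict Implicit.
Unset Printing Implicit Defensive.

Import Order.TTheory GRing.Theory Num.Theory.
Local Open Scope ring_scope.

Definition walk (X : finType) (e : rel X) (n : nat) (y z : X) : bool :=
  [exists p : n.-tuple X, path e y p && (last y p == z)].

(* Length of a shortest path; in a connected graph it is less than #|X|, so
   the search never overflows. *)
Definition dist (X : finType) (e : rel X) (y z : X) : nat :=
  find (fun n => walk e n y z) (iota 0 #|X|).

Definition diameter (X : finType) (e : rel X) : nat :=
  \max_(y : X) \max_(z : X) dist e y z.

Definition connected_simple_graph (X : finType) (e : rel X) : Prop :=
  [/\ symmetric e, irreflexive e & forall y z, connect e y z].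

(* p h i j is the intersection number p^h_{ij}. *)
Definition distance_regular (X : finType) (e : rel X)
    (p : nat -> nat -> nat -> nat) : Prop :=
  connected_simple_graph e /\
  forall (h i j : nat) (y z : X),
    (h <= diameter e)%N -> (i <= diameter e)%N -> (j <= diameter e)%N ->
    dist e y z = h ->
    #|[set w | (dist e y w == i) && (dist e w z == j)]| = p h i j.

(* Matrices and vectors indexed by X have dimension #|X|: the index i stands
   for the vertex enum_val i. *)

Definition distmx (C : numClosedFieldType) (X : finType) (e : rel X) (i : nat) :
    'M[C]_#|X| :=
  \matrix_(a, b) (dist e (enum_val a) (enum_val b) == i)%:R.

Definition adjmx (C : numClosedFieldType) (X : finType) (e : rel X) :
    'M[C]_#|X| := distmx C e 1.

Definition allones (C : numClosedFieldType) (X : finType) : 'M[C]_#|X| :=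
  const_mx 1.

Definition dual_idem (C : numClosedFieldType) (X : finType) (e : rel X) (x : X)
    (i : nat) : 'M[C]_#|X| :=
  diag_mx (\row_a (dist e x (enum_val a) == i)%:R).

Definition hat (C : numClosedFieldType) (X : finType) (y : X) : 'cV[C]_#|X| :=
  delta_mx (enum_rank y) 0.

Definition sphere_vec (C : numClosedFieldType) (X : finType) (e : rel X) (x : X)
    (i : nat) : 'cV[C]_#|X| :=
  \sum_(y : X | dist e x y == i) hat C y.

Definition inner (C : numClosedFieldType) (n : nat) (u w : 'cV[C]_n) : C :=
  (u^T *m map_mx Num.conj w) 0 0.

Definition subalgebra (C : numClosedFieldType) (n : nat)
    (U : {vspace 'M[C]_n}) : Prop :=
  1%:M \in U /\ forall P Q, P \in U -> Q \in U -> P *m Q \in U.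

Definition generated_algebra (C : numClosedFieldType) (n : nat)
    (S : 'M[C]_n -> Prop) (B : 'M[C]_n) : Prop :=
  forall U : {vspace 'M[C]_n},
    subalgebra U -> (forall P, S P -> P \in U) -> B \in U.

Definition bose_mesner (C : numClosedFieldType) (X : finType) (e : rel X) :
    'M[C]_#|X| -> Prop :=
  generated_algebra (fun P => P = adjmx C e).

Definition terwilliger (C : numClosedFieldType) (X : finType) (e : rel X)
    (x : X) : 'M[C]_#|X| -> Prop :=
  generated_algebra (fun P => P = adjmx C e \/
    exists2 i : nat, (i <= diameter e)%N & P = dual_idem C e x i).

Definition mximg (C : numClosedFieldType) (n : nat) (B : 'M[C]_n)
    (W : {vspace 'cV[C]_n}) : {vspace 'cV[C]_n} :=
  (linfun (mulmx B : 'cV[C]_n -> 'cV[C]_n) @: W)%VS.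

Definition Tmodule (C : numClosedFieldType) (X : finType) (e : rel X) (x : X)
    (W : {vspace 'cV[C]_#|X|}) : Prop :=
  forall B w, terwilliger e x B -> w \in W -> B *m w \in W.

Definition irreducible_Tmodule (C : numClosedFieldType) (X : finType)
    (e : rel X) (x : X) (W : {vspace 'cV[C]_#|X|}) : Prop :=
  [/\ Tmodule e x W, W != 0%VS &
      forall U : {vspace 'cV[C]_#|X|},
        Tmodule e x U -> (U <= W)%VS -> U = 0%VS \/ U = W].

Definition has_endpoint (C : numClosedFieldType) (X : finType) (e : rel X)
    (x : X) (W : {vspace 'cV[C]_#|X|}) (r : nat) : Prop :=
  [/\ (r <= diameter e)%N, mximg (dual_idem C e x r) W != 0%VS &
      forall i, (i < r)%N -> mximg (dual_idem C e x i) W = 0%VS].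

Definition thin (C : numClosedFieldType) (X : finType) (e : rel X) (x : X)
    (W : {vspace 'cV[C]_#|X|}) : Prop :=
  forall i, (i <= diameter e)%N -> (\dim (mximg (dual_idem C e x i) W) <= 1)%N.

Definition thin_irreducible_endpoint1 (C : numClosedFieldType) (X : finType)
    (e : rel X) (x : X) (W : {vspace 'cV[C]_#|X|}) : Prop :=
  [/\ irreducible_Tmodule e x W, thin e x W & has_endpoint e x W 1].

(* Meaningful for W thin irreducible with endpoint 1, where E*_1 W is a line
   and eta is therefore unique. *)
Definition local_eigenvalue (C : numClosedFieldType) (X : finType) (e : rel X)
    (x : X) (W : {vspace 'cV[C]_#|X|}) (eta : C) : Prop :=
  forall w, w \in mximg (dual_idem C e x 1) W ->
    (dual_idem C e x 1 *m adjmx C e *m dual_idem C e x 1) *m w = eta *: w.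

(* In option C, None stands for infinity. *)

Definition pseudo_space (C : numClosedFieldType) (X : finType) (e : rel X)
    (theta : option C) (Y : 'M[C]_#|X|) : Prop :=
  match theta with
  | Some t => bose_mesner e Y /\
      exists c : C, (adjmx C e - t%:M) *m Y = c *: distmx C e (diameter e)
  | None => exists c : C, Y = c *: distmx C e (diameter e)
  end.

Definition pseudo_primitive_idempotent (C : numClosedFieldType) (X : finType)
    (e : rel X) (theta : option C) (Y : 'M[C]_#|X|) : Prop :=
  Y <> 0 /\ pseudo_space e theta Y.

Definition tilde (C : numClosedFieldType) (b1 : nat) (eta : option C) :
    option C :=
  match eta with
  | None => Some (-1)
  | Some t => if t == -1 then None else Some (-1 - b1%:R / (1 + t))
  end.

(* The set (M; v). *)
Definition bm_vec (C : numClosedFieldType) (X : finType) (e : rel X) (x : X)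
    (v : 'cV[C]_#|X|) (P : 'M[C]_#|X|) : Prop :=
  bose_mesner e P /\ P *m v \in mximg (dual_idem C e x (diameter e)) fullv.

Definition is_subspace (K : fieldType) (V : vectType K) (S : V -> Prop)
    (U : {vspace V}) : Prop :=
  forall P, S P <-> P \in U.

(* Main.v *)
(** Write S_j for the 0/1 matrix of the relation d(y, z) < j; these
    matrices span M, and S_(D+1) = J. Since v lies in E*_1 V and J v = 0, the
    vector S_(j+1) v lives on the spheres of radius j and j + 1 around x; its
    two components are v^+_(j+1) and -v^-_j. Hence sum_j g_j S_(j+1) lies in
    (M; v) iff g_i v^+_(i+1) = g_(i+1) v^-_(i+1) for i + 1 < D.

    Counting gives <v^-_j, v^+_j> = c <S_2 v, v> with c <> 0, and S_j v <> 0 for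
    j <= D when <S_2 v, v> = 0. If v lies in a thin irreducible module this
    yields v^+_j <> 0 for 0 < j < D, so dim (M; v) <= 2. In such a module the
    lowering map E*_j W <- E*_(j+1) W is injective for j >= 1; as eta~ is exactly
    the value for which E*_1 E v = 0, the relation (A - eta~) E in C A_D forces
    E*_i E v = 0 for all i < D. Finally E is not a multiple of J, because
    eta~ = k would make the local eigenvalue eta = -1 - b_1 / (k + 1) a
    non-integral rational. Conversely, an element of (M; v) outside C J forces
    v^-_j to be a multiple of v^+_j <> 0, and then M v is the required module. *)

Require Import Defs.
From HB Require Import structures.
From mathcomp Require Import all_boot all_order all_algebra.
From mathcomp Require Import boolp reals complex zify ring.

Set Implicit Arguments.
Unset Strict Implicit.
Unset Printing Implicit Defensive.

Import Order.TTheory GRing.Theory Num.Theory.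
Local Open Scope ring_scope.
Local Open Scope complex_scope.

(** * Distances in a connected graph *)

Section GraphDistance.

Variables (X : finType) (e : rel X).
Hypothesis connected_e : connected_simple_graph e.

Lemma walkP n y z :
  reflect (exists2 s, path e y s & last y s = z /\ size s = n) (walk e n y z).
Proof.
apply: (iffP existsP) => [[s /andP[es /eqP ls]]|[s es [ls /eqP ss]]].
  by exists s => //; rewrite size_tuple.
by exists (Tuple ss); rewrite es ls eqxx.
Qed.

Lemma walk_cat m n y z w : walk e m y z -> walk e n z w -> walk e (m + n) y w.
Proof.
move=> /walkP[s es [<- <-]] /walkP[t et [<- <-]].
by apply/walkP; exists (s ++ t); rewrite ?cat_path ?es ?last_cat ?size_cat.
Qed.

Lemma walk_sym n y z : walk e n y z -> walk e n z y.
Proof.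
case: connected_e => sym_e _ _ /walkP[s es [<- <-]].
apply/walkP; exists (rev (belast y s)); last first.
  by rewrite size_rev size_belast; split=> //; case: s es => //= a s _;
     rewrite rev_cons last_rcons.
by rewrite rev_path; under eq_path do rewrite sym_e.
Qed.

Lemma walk_split m n y w :
  walk e (m + n) y w -> exists2 z, walk e m y z & walk e n z w.
Proof.
move=> /walkP[s es [<- ss]]; exists (last y (take m s)).
  apply/walkP; exists (take m s); first exact: take_path.
  by rewrite size_takel // ss leq_addr.
apply/walkP; exists (drop m s); last first.
  by rewrite -last_cat cat_take_drop size_drop ss addKn.
by move: es; rewrite -{1}(cat_take_drop m s) cat_path => /andP[].
Qed.

Lemma dist_le n y z : walk e n y z -> (dist e y z <= n)%N.
Proof.
move=> yz; rewrite leqNgt; apply/negP => lt_n.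
have ltX : (n < #|X|)%N.
  by apply: leq_trans lt_n _; rewrite -[leqRHS](size_iota 0) find_size.
by have := before_find 0 lt_n; rewrite nth_iota ?add0n // yz.
Qed.

Lemma dist_walk y z : walk e (dist e y z) y z.
Proof.
have has_walk : has (fun n => walk e n y z) (iota 0 #|X|).
  case: connected_e => _ _ /(_ y z)/connectP[s es zE].
  case: (shortenP es) zE => s' es' uniq_s' _ zE.
  apply/hasP; exists (size s'); last by apply/walkP; exists s'.
  rewrite mem_iota /= add0n.
  by have := max_card [in y :: s']; rewrite (card_uniqP uniq_s').
have := nth_find 0 has_walk; rewrite nth_iota ?add0n //.
by rewrite -[ltnRHS](size_iota 0) -has_find.
Qed.

Lemma dist_sym y z : dist e y z = dist e z y.
Proof.
by apply/eqP; rewrite eqn_leq; apply/andP; split;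
   apply/dist_le/walk_sym/dist_walk.
Qed.

Lemma dist_triangle z y w : (dist e y w <= dist e y z + dist e z w)%N.
Proof. by apply/dist_le/walk_cat/dist_walk/dist_walk. Qed.

Lemma dist_eq0 y z : (dist e y z == 0%N) = (y == z).
Proof.
apply/eqP/eqP => [d0|->].
  by have /walkP[s _ []] := dist_walk y z; rewrite d0 => <- /size0nil ->.
by apply/eqP; rewrite -leqn0 dist_le //; apply/walkP; exists [::].
Qed.

Lemma dist_le_diameter y z : (dist e y z <= diameter e)%N.
Proof.
apply: leq_trans (leq_bigmax (F := fun z => dist e y z) z) _.
exact: (leq_bigmax (F := fun y => \max_z dist e y z) y).
Qed.

Lemma geodesic_split y w m n : dist e y w = (m + n)%N ->
  exists2 z, dist e y z = m & dist e z w = n.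
Proof.
move=> dyw; have := dist_walk y w; rewrite dyw => /walk_split[z yz zw].
exists z; have := dist_triangle z y w; move: (dist_le yz) (dist_le zw); lia.
Qed.

Lemma exists_dist n (x0 : X) : (n <= diameter e)%N ->
  exists y, exists z, dist e y z = n.
Proof.
move=> le_n.
have X_gt0 : (0 < #|X|)%N by apply/card_gt0P; exists x0.
have [y dy] := @bigop.eq_bigmax X (fun y => \max_z dist e y z) X_gt0.
have [z dz] := @bigop.eq_bigmax X (fun z => dist e y z) X_gt0.
have dyz : dist e y z = (n + (diameter e - n))%N.
  by rewrite subnKC // -dz -dy.
by have [w dyw _] := geodesic_split dyz; exists y; exists w.
Qed.

End GraphDistance.

(** * Linear algebra *)

(** Adjoin vectors of [S] to a subspace until none is left outside; the codimension bounds the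
    number of steps. This turns predicates closed under linear combinations into the vector spaces
    over which algebras and modules are defined. *)
Lemma subspace_exists (K : fieldType) (V : vectType K) (S : V -> Prop) :
    S 0 -> (forall a u w, S u -> S w -> S (a *: u + w)) ->
  exists U : {vspace V}, is_subspace S U.
Proof.
move=> S0 SZD.
suff grow n (U : {vspace V}) : (\dim {:V} - \dim U <= n)%N ->
    (forall u, u \in U -> S u) -> exists U' : {vspace V}, is_subspace S U'.
  apply: (grow (\dim {:V}) 0%VS); first by rewrite dimv0 subn0.
  by move=> u; rewrite memv0 => /eqP->.
elim: n U => [|n IHn] U codimU US.
  exists U => u; split=> [Su|]; last exact: US.
  suff -> : U = fullv by rewrite memvf.
  by apply/eqP; rewrite eqEdim subvf /=; move: codimU; rewrite leqn0 subn_eq0.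
have [SU|/existsNP[u /not_implyP[Su /negP Uu]]] :=
    pselect (forall u, S u -> u \in U).
  by exists U => u; split=> [/SU|/US].
apply: (IHn (<[u]> + U)%VS) => [|w /memv_addP[_ /vlineP[a ->] [w' Uw' ->]]].
  have u0 : u != 0 by apply: contraNneq Uu => ->; rewrite mem0v.
  rewrite dimv_disjoint_sum; last first.
    apply/eqP; rewrite -subv0; apply/subvP => w.
    rewrite memv_cap => /andP[/vlineP[a ->] Uau].
    have [->|a0] := eqVneq a 0; first by rewrite scale0r mem0v.
    by case/negP: Uu; rewrite -(scalerK a0 u) memvZ.
  by rewrite dim_vline u0; move: codimU; lia.
by apply: SZD => //; apply: US.
Qed.

Lemma mem_line_of_dim_le1 (K : fieldType) (V : vectType K) (U : {vspace V})
    (u w : V) : (\dim U <= 1)%N -> w != 0 -> w \in U -> u \in U ->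
  exists a, u = a *: w.
Proof.
move=> dimU w0 Uw Uu; apply/vlineP; suff -> : <[w]>%VS = U by [].
by apply/eqP; rewrite eqEdim -memvE Uw dim_vline w0.
Qed.

Section InnerProduct.

Variables (C : numClosedFieldType) (n : nat).
Implicit Types u w : 'cV[C]_n.

Lemma innerE u w : inner u w = \sum_a u a 0 * (w a 0)^*.
Proof. by rewrite /inner mxE; apply: eq_bigr => a _; rewrite !mxE. Qed.

Lemma inner0l w : inner 0 w = 0.
Proof. by rewrite innerE big1 // => a _; rewrite mxE mul0r. Qed.

Lemma inner0r u : inner u 0 = 0.
Proof. by rewrite innerE big1 // => a _; rewrite mxE conjC0 mulr0. Qed.

Lemma innerDl u1 u2 w : inner (u1 + u2) w = inner u1 w + inner u2 w.
Proof. by rewrite /inner linearD mulmxDl mxE. Qed.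

Lemma innerZl a u w : inner (a *: u) w = a * inner u w.
Proof. by rewrite /inner linearZ -scalemxAl mxE. Qed.

Lemma innerZr a u w : inner u (a *: w) = a^* * inner u w.
Proof.
rewrite !innerE mulr_sumr; apply: eq_bigr => b _.
by rewrite mxE rmorphM /= mulrCA.
Qed.

Lemma inner_eq0 w : inner w w = 0 -> w = 0.
Proof.
rewrite innerE => ww0; apply/matrixP => a i; rewrite ord1 [RHS]mxE; apply/eqP.
have := psumr_eq0P (F := fun a => w a 0 * (w a 0)^*).
move=> /(_ predT) H; have /eqP := H (fun b _ => mul_conjC_ge0 _) ww0 a isT.
by rewrite mul_conjC_eq0.
Qed.

Lemma inner_mulmx_sym (M : 'M[C]_n) u w :
  M^T = M -> map_mx Num.conj M = M -> inner (M *m u) w = inner u (M *m w).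
Proof. by move=> MT Mc; rewrite /inner trmx_mul map_mxM Mc MT mulmxA. Qed.

End InnerProduct.

(** * The Bose-Mesner algebra *)

Section BoseMesner.

Variables (C : numClosedFieldType) (X : finType) (e : rel X).
Variable p : nat -> nat -> nat -> nat.
Hypothesis drg : distance_regular e p.

Let D := diameter e.
Let connected_e : connected_simple_graph e := proj1 drg.
Local Notation d y z := (dist e y z).
Local Notation A := (adjmx C e).

Lemma sum_enum_val (F : X -> C) :
  \sum_(c < #|X|) F (enum_val c) = \sum_w F w.
Proof. by rewrite [RHS](reindex _ (onW_bij _ (@enum_val_bij X))). Qed.

Lemma sum_sphere_pair i j y z : (i <= D)%N -> (j <= D)%N ->
  \sum_w (d y w == i)%:R * (d w z == j)%:R = (p (d y z) i j)%:R :> C.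
Proof.
move=> le_i le_j; case: drg => _ /(_ _ i j y z (dist_le_diameter e y z)) <- //.
rewrite -sum1dep_card natr_sum [RHS]big_mkcond /=.
by apply: eq_bigr => w _; rewrite -natrM mulnb; case: ifP.
Qed.

(** Splitting by the distances of [w] to [y] and [z] shows that the sum depends only on [d y z]; so
    functions of distance are closed under the matrix product. *)
Lemma sum_dist_mul (f g : nat -> C) y z :
  \sum_w f (d y w) * g (d w z) =
  \sum_(i < D.+1) \sum_(j < D.+1) f i * g j * (p (d y z) i j)%:R.
Proof.
have part (h : nat -> C) n : (n <= D)%N ->
    h n = \sum_(i < D.+1) (n == i)%:R * h i.
  move=> le_n; rewrite (bigD1 (Ordinal (le_n : n < D.+1)%N)) //= eqxx mul1r.
  rewrite big1 ?addr0 // => i; rewrite -val_eqE /= eq_sym => /negPf->.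
  by rewrite mul0r.
transitivity (\sum_w \sum_(i < D.+1) \sum_(j < D.+1)
    f i * g j * ((d y w == i)%:R * (d w z == j)%:R)).
  apply: eq_bigr => w _; rewrite (part f) ?dist_le_diameter //.
  rewrite mulr_suml; apply: eq_bigr => i _.
  rewrite (part g (d w z)) ?dist_le_diameter // mulr_sumr.
  by apply: eq_bigr => j _; ring.
rewrite exchange_big; apply: eq_bigr => i _.
rewrite exchange_big; apply: eq_bigr => j _ /=.
by rewrite -mulr_sumr sum_sphere_pair // -ltnS.
Qed.

(** The partial sum A_0 + ... + A_(j-1). It serves better than A_j because S_j v lives on two
    spheres around x, whereas A_j v may meet three. *)
Definition ballmx (j : nat) : 'M[C]_#|X| :=
  \matrix_(a, b) (d (enum_val a) (enum_val b) < j)%:R.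

Local Notation S := ballmx.

Lemma ballmx0 : S 0 = 0.
Proof. by apply/matrixP => a b; rewrite !mxE. Qed.

Lemma ballmx1 : S 1 = 1%:M.
Proof.
apply/matrixP => a b.
by rewrite !mxE ltnS leqn0 dist_eq0 // (inj_eq enum_val_inj).
Qed.

Lemma ballmx_diameter : S D.+1 = allones C X.
Proof. by apply/matrixP => a b; rewrite !mxE ltnS dist_le_diameter. Qed.

Lemma distmx_ballmx i : distmx C e i = S i.+1 - S i.
Proof.
apply/matrixP => a b; rewrite !mxE ltnS.
by case: ltngtP => _; rewrite ?subr0 ?subrr.
Qed.

Lemma adjmx_ballmx_diff : A = S 2 - 1%:M.
Proof. by rewrite /adjmx distmx_ballmx ballmx1. Qed.

Lemma ballmx_tr j : (S j)^T = S j.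
Proof. by apply/matrixP => a b; rewrite !mxE dist_sym. Qed.

Lemma ballmx_conj j : map_mx Num.conj (S j) = S j.
Proof. by apply/matrixP => a b; rewrite !mxE conjC_nat. Qed.

Lemma adjmx_tr : A^T = A.
Proof. by apply/matrixP => a b; rewrite !mxE dist_sym. Qed.

Lemma adjmx_conj : map_mx Num.conj A = A.
Proof. by apply/matrixP => a b; rewrite !mxE conjC_nat. Qed.

Lemma intersection_number_gt0 h i j y z w : d y z = h -> d y w = i ->
  d w z = j -> (0 < p h i j)%N.
Proof.
move=> <- <- <-; case: drg => _.
move=> /(_ (d y z) (d y w) (d w z) y z) <-; rewrite ?dist_le_diameter //.
by apply/card_gt0P; exists w; rewrite inE !eqxx.
Qed.

(** The number is c_(j+1); a geodesic of length j + 1 exhibits one such neighbour. *)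
Lemma c_gt0 (x0 : X) j : (j < D)%N -> (0 < p j.+1 1 j)%N.
Proof.
move=> lt_j; have [y [z dyz]] := exists_dist connected_e x0 lt_j.
have [w dyw dwz] := geodesic_split connected_e (dyz : d y z = (1 + j)%N).
exact: intersection_number_gt0 dyz dyw dwz.
Qed.

(** The number is b_j, read off the same geodesic from its second vertex. *)
Lemma b_gt0 (x0 : X) j : (j < D)%N -> (0 < p j 1 j.+1)%N.
Proof.
move=> lt_j; have [y [z dyz]] := exists_dist connected_e x0 lt_j.
have [w dyw dwz] := geodesic_split connected_e (dyz : d y z = (1 + j)%N).
by apply: intersection_number_gt0 dwz _ dyz; rewrite dist_sym.
Qed.

Lemma valency_sum y : (0 < D)%N -> \sum_w (d y w == 1%N)%:R = (p 0 1 1)%:R :> C.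
Proof.
move=> D0; have dyy : d y y = 0%N by apply/eqP; rewrite dist_eq0.
have := sum_sphere_pair y y D0 D0; rewrite dyy => <-; apply: eq_bigr => w _.
by rewrite (dist_sym connected_e w) -natrM mulnb andbb.
Qed.

(** Count the neighbours of y within distance j of z: there are k, k - b_j, c_(j+1) or 0 of them
    according as d(y, z) is less than j, equal to j, equal to j + 1, or larger. *)
Lemma adjmx_ballmx j : (j < D)%N ->
  A *m S j.+1 = (p j.+1 1 j)%:R *: S j.+2 +
    ((p 0 1 1)%:R - (p j 1 j.+1)%:R - (p j.+1 1 j)%:R) *: S j.+1 +
    (p j 1 j.+1)%:R *: S j.
Proof.
move=> lt_j; have D0 : (0 < D)%N by apply: leq_ltn_trans lt_j.
apply/matrixP => a b; set y := enum_val a; set z := enum_val b.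
rewrite !mxE -/y -/z.
transitivity (\sum_w (d y w == 1%N)%:R * (d w z < j.+1)%:R : C).
  by rewrite -sum_enum_val; apply: eq_bigr => c _; rewrite !mxE.
have [lt_h|gt_h|eq_h] := ltngtP (d y z) j.
- have -> : \sum_w (d y w == 1%N)%:R * (d w z < j.+1)%:R =
            \sum_w (d y w == 1%N)%:R :> C.
    apply: eq_bigr => w _; case: eqP => [dw|]; rewrite ?mul0r ?mul1r //.
    have := dist_triangle connected_e y w z; rewrite (dist_sym connected_e w y).
    by move=> ?; have -> : (d w z < j.+1)%N by lia.
  have -> : (d y z < j.+2)%N by lia.
  have -> : (d y z < j.+1)%N by lia.
  by rewrite valency_sum //=; ring.
- have [eq_h|gt_h1] := eqVneq (d y z) j.+1.
    have -> : \sum_w (d y w == 1%N)%:R * (d w z < j.+1)%:R =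
              \sum_w (d y w == 1%N)%:R * (d w z == j)%:R :> C.
      apply: eq_bigr => w _; case: eqP => [dw|]; rewrite ?mul0r ?mul1r //.
      have := dist_triangle connected_e w y z.
      by move=> ?; congr _%:R; lia.
    by rewrite sum_sphere_pair ?(ltnW lt_j) // eq_h ltnn ltnSn /=; ring.
  rewrite big1 => [|w _]; last first.
    case: eqP => [dw|]; rewrite ?mul0r ?mul1r //.
    have := dist_triangle connected_e w y z => ?.
    by have -> : (d w z < j.+1)%N = false by lia.
  have -> : (d y z < j.+2)%N = false by lia.
  have -> : (d y z < j.+1)%N = false by lia.
  by rewrite /=; ring.
- have -> : \sum_w (d y w == 1%N)%:R * (d w z < j.+1)%:R =
            \sum_w (d y w == 1%N)%:R -
            \sum_w (d y w == 1%N)%:R * (d w z == j.+1)%:R :> C.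
    rewrite -sumrB; apply: eq_bigr => w _.
    case: eqP => [dw|]; rewrite ?mul0r ?mul1r ?subr0 //.
    have := dist_triangle connected_e y w z; rewrite (dist_sym connected_e w y).
    move=> ?; have [->|/eqP ne] := eqVneq (d w z) j.+1.
      by rewrite ltnn subrr.
    by rewrite subr0; have -> : (d w z < j.+1)%N by lia.
  rewrite valency_sum // sum_sphere_pair // eq_h ltnSn.
  by rewrite ltnS leqnSn /=; ring.
Qed.

(** Abel summation: f(h) is the sum over h <= j <= D of the differences f(j) - f(j+1). *)
Lemma dist_function_ballmx (f : nat -> C) (B : 'M[C]_#|X|) :
    (forall a b, B a b = f (d (enum_val a) (enum_val b))) ->
  exists g : nat -> C, B = \sum_(j < D.+1) g j *: S j.+1.
Proof.
(* Cutting f off beyond D makes the telescoping sum end in 0. *)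
move=> Bf; pose f' j := if (j <= D)%N then f j else 0.
exists (fun j => f' j - f' j.+1); apply/matrixP => a b; rewrite Bf summxE.
set h := d _ _; have le_h : (h <= D)%N by exact: dist_le_diameter.
rewrite (eq_bigr (fun j : 'I_D.+1 =>
  if (h <= j)%N then f' j - f' j.+1 else 0)); last first.
  move=> j _; rewrite !mxE ltnS -/h.
  by case: (h <= j)%N; rewrite ?mulr1 ?mulr0.
rewrite -(big_mkord xpredT (fun j => if (h <= j)%N then f' j - f' j.+1 else 0)).
rewrite (big_cat_nat (n := h)) ?leqW //= big_nat big1 ?add0r; last first.
  by move=> j /andP[_]; rewrite ltnNge => /negPf->.
rewrite big_nat (eq_bigr (fun j => - (f' j.+1 - f' j))); last first.
  by move=> j /andP[-> _]; rewrite opprB.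
rewrite -big_nat sumrN telescope_sumr ?leqW // /f' le_h ltnn.
by rewrite sub0r opprK.
Qed.

(** Since c_(j+1) is nonzero, the three-term recurrence can be solved for S_(j+2); hence the
    induction on two consecutive indices. *)
Lemma ballmx_in_algebra (x0 : X) (U : {vspace 'M[C]_#|X|}) j :
  subalgebra U -> A \in U -> (j <= D.+1)%N -> S j \in U.
Proof.
move=> [U1 UM] UA.
suff both i : (i <= D)%N -> S i \in U /\ S i.+1 \in U.
  case: j => [|j] le_j; last by case: (both j le_j).
  by rewrite ballmx0 mem0v.
elim: i => [|i IHi] le_i; first by rewrite ballmx0 ballmx1 mem0v U1.
have [Ui Ui1] := IHi (ltnW le_i); split=> //.
have c0 : (p i.+1 1 i)%:R != 0 :> C by rewrite pnatr_eq0 -lt0n (c_gt0 x0).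
have := adjmx_ballmx le_i => /(canLR (addrK _))/(canLR (addrK _)) rec.
rewrite -(scalerK c0 (S i.+2)) -rec memvZ // !rpredB ?rpredZ // ?UM //.
Qed.

(** Matrices whose entries depend on distance alone form an algebra containing A, which gives one
    inclusion; for the other, the ball matrices lie in every algebra that contains A. *)
Lemma bose_mesnerP (x0 : X) (B : 'M[C]_#|X|) :
  bose_mesner e B <-> exists g : nat -> C, B = \sum_(j < D.+1) g j *: S j.+1.
Proof.
split=> [BM|[g ->] U algU UA]; last first.
  apply: memv_suml => j _; apply/memvZ/ballmx_in_algebra => //; exact: UA.
pose distfun (M : 'M[C]_#|X|) :=
  exists f : nat -> C, forall a b, M a b = f (d (enum_val a) (enum_val b)).
have [||U UP] := @subspace_exists _ _ distfun.
- by exists (fun=> 0) => a b; rewrite mxE.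
- move=> c M N [f Mf] [g Ng]; exists (fun i => c * f i + g i) => a b.
  by rewrite !mxE Mf Ng.
suff /UP[f Bf] : B \in U by apply: dist_function_ballmx Bf.
apply: BM => [|_ ->]; last first.
  by apply/UP; exists (fun i => (i == 1%N)%:R) => a b; rewrite mxE.
split=> [|M N /UP[f Mf] /UP[g Ng]]; apply/UP.
  exists (fun i => (i < 1)%:R) => a b; by rewrite -ballmx1 mxE.
exists (fun h => \sum_(i < D.+1) \sum_(j < D.+1) f i * g j * (p h i j)%:R) => a b.
rewrite -sum_dist_mul -sum_enum_val mxE.
by apply: eq_bigr => c _; rewrite Mf Ng.
Qed.

Lemma bose_mesner_ballmx (x0 : X) j : (j <= D.+1)%N -> bose_mesner e (S j).
Proof. by move=> le_j U algU UA; apply: ballmx_in_algebra => //; apply: UA. Qed.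

Lemma bose_mesnerZD c (B B' : 'M[C]_#|X|) :
  bose_mesner e B -> bose_mesner e B' -> bose_mesner e (c *: B + B').
Proof.
by move=> BB BB' U algU UA; apply: rpredD; [apply: rpredZ; apply: BB|apply: BB'].
Qed.

Lemma bose_mesner_adjmxM (B : 'M[C]_#|X|) :
  bose_mesner e B -> bose_mesner e (A *m B).
Proof. by move=> BB U algU UA; apply: (proj2 algU); [apply: UA|apply: BB]. Qed.

End BoseMesner.

(** * The vectors v^+_j and v^-_j *)

Section Subconstituents.

Variables (C : numClosedFieldType) (X : finType) (e : rel X) (x : X).
Local Notation D := (diameter e).
Local Notation d y z := (dist e y z).
Local Notation V a := (@enum_val X (fun _ : X => true) a).
Local Notation l a := (dist e x (V a)).
Local Notation E := (dual_idem C e x).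
Local Notation A := (adjmx C e).

Lemma dual_idemE i (w : 'cV[C]_#|X|) (a : 'I_#|X|) :
  (E i *m w) a 0 = if l a == i then w a 0 else 0.
Proof.
by rewrite mul_diag_mx !mxE; case: eqP => _; rewrite ?mul1r ?mul0r.
Qed.

Lemma dual_idem_fixP i (w : 'cV[C]_#|X|) :
  E i *m w = w <-> (forall a : 'I_#|X|, l a != i -> w a 0 = 0).
Proof.
split=> [<- a /negPf la|w0]; first by rewrite dual_idemE la.
apply/colP => a; rewrite dual_idemE; have [//|ne] := eqVneq (l a) i.
by rewrite w0.
Qed.

Lemma dual_idem_eq0P i (w : 'cV[C]_#|X|) :
  E i *m w = 0 <-> (forall a : 'I_#|X|, l a = i -> w a 0 = 0).
Proof.
split=> [Ew a la|w0].
  by have /colP/(_ a) := Ew; rewrite dual_idemE la eqxx mxE.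
apply/colP => a; rewrite dual_idemE mxE; have [la|//] := eqVneq (l a) i.
exact: w0.
Qed.

Lemma dual_idemM i j (w : 'cV[C]_#|X|) :
  E i *m (E j *m w) = if i == j then E i *m w else 0.
Proof.
apply/colP => a; rewrite !dual_idemE.
have [->|ne] := eqVneq i j; first by rewrite dual_idemE; case: eqP.
by rewrite mxE; case: eqP => // ->; rewrite (negPf ne).
Qed.

Lemma dual_idem_idem i (w : 'cV[C]_#|X|) : E i *m (E i *m w) = E i *m w.
Proof. by rewrite dual_idemM eqxx. Qed.

Lemma mem_mximg_fullvP i (w : 'cV[C]_#|X|) :
  w \in mximg (E i) fullv <-> E i *m w = w.
Proof.
split=> [/memv_imgP[u _ ->]|<-]; first by rewrite lfunE /= dual_idem_idem.
by rewrite -[X in X \in _]lfunE memv_img // memvf.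
Qed.

Lemma mem_mximg i (w : 'cV[C]_#|X|) (W : {vspace 'cV[C]_#|X|}) :
  w \in W -> E i *m w \in mximg (E i) W.
Proof. by move=> Ww; rewrite -[X in X \in _]lfunE memv_img. Qed.

Lemma mem_mximg_diameterP (w : 'cV[C]_#|X|) :
  w \in mximg (E D) fullv <-> (forall i, (i < D)%N -> E i *m w = 0).
Proof.
split=> [/mem_mximg_fullvP <- i lt_i|Ew].
  by rewrite dual_idemM (ltn_eqF lt_i).
apply/mem_mximg_fullvP/dual_idem_fixP => a ne.
apply: (proj1 (dual_idem_eq0P (l a) w)) => //; apply: Ew.
by rewrite ltn_neqAle ne dist_le_diameter.
Qed.

Lemma inner_dual_idem i (u w : 'cV[C]_#|X|) :
  inner (E i *m u) w = inner (E i *m u) (E i *m w).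
Proof.
rewrite !innerE; apply: eq_bigr => a _; rewrite !dual_idemE.
by case: eqP => // _; rewrite !mul0r.
Qed.

Lemma inner_dual_idemC i (u w : 'cV[C]_#|X|) :
  inner u (E i *m w) = inner (E i *m u) (E i *m w).
Proof.
rewrite !innerE; apply: eq_bigr => a _; rewrite !dual_idemE.
by case: eqP => // _; rewrite conjC0 !mulr0.
Qed.

Hypothesis connected_e : connected_simple_graph e.

(** A is block tridiagonal for the spheres around x: the distances of adjacent vertices from x
    differ by at most 1. *)
Lemma adjmx_dual_idem_eq0 i j (w : 'cV[C]_#|X|) :
  (j.+1 < i)%N || (i.+1 < j)%N -> E j *m (A *m (E i *m w)) = 0.
Proof.
move=> ij; apply/dual_idem_eq0P => a la; rewrite mxE big1 // => b _.
rewrite dual_idemE mxE; case: eqP => [dab|]; rewrite ?mul0r ?mul1r //.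
have := dist_triangle connected_e (V a) x (V b).
have := dist_triangle connected_e (V b) x (V a).
by rewrite (dist_sym connected_e (V b)) => ? ?; case: eqP => // lb; exfalso; lia.
Qed.

Lemma sum_dual_idem (w : 'cV[C]_#|X|) : w = \sum_(i < D.+1) E i *m w.
Proof.
apply/colP => a; rewrite summxE.
have lt_a : (l a < D.+1)%N by rewrite ltnS dist_le_diameter.
rewrite (bigD1 (Ordinal lt_a)) //= dual_idemE eqxx big1 ?addr0 // => i.
rewrite -val_eqE /= eq_sym => ne; by rewrite dual_idemE (negPf ne).
Qed.

End Subconstituents.

(** * Vectors of E*_1 V whose entries sum to zero *)

Section LocalVector.

Variables (C : numClosedFieldType) (X : finType) (e : rel X) (x : X).
Variable p : nat -> nat -> nat -> nat.
Hypothesis drg : distance_regular e p.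

Local Notation D := (diameter e).
Let connected_e : connected_simple_graph e := proj1 drg.
Local Notation d y z := (dist e y z).
Local Notation V a := (@enum_val X (fun _ : X => true) a).
Local Notation l a := (dist e x (V a)).
Local Notation E := (dual_idem C e x).
Local Notation A := (adjmx C e).
Local Notation S := (ballmx C e).

Variable v : 'cV[C]_#|X|.
Hypothesis v_level : E 1 *m v = v.
Hypothesis v_sum : \sum_a v a 0 = 0.

(** From a vertex of level below j - 1 the whole first sphere is at distance less than j, so the
    entry is the full sum of v, which is zero; from a level above j no vertex of that sphere is. *)
Lemma ballmx_v_eq0 j (a : 'I_#|X|) :
  (l a < j.-1)%N || (j < l a)%N -> (S j *m v) a 0 = 0.
Proof.
move=> la; have v0 (b : 'I_#|X|) : l b <> 1%N -> v b 0 = 0.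
  by move/eqP; apply: (proj1 (dual_idem_fixP _ _ _ _) v_level).
have [lt_la|gt_la] := orP la.
  rewrite -[RHS]v_sum mxE; apply: eq_bigr => b _; rewrite mxE.
  have [lb|/v0->] := pselect (l b = 1%N); last by rewrite mulr0.
  have := dist_triangle connected_e x (V a) (V b).
  rewrite (dist_sym connected_e _ x) => ?.
  have -> : (d (V a) (V b) < j)%N by lia.
  by rewrite mul1r.
rewrite mxE big1 // => b _; rewrite mxE.
have [lb|/v0->] := pselect (l b = 1%N); last by rewrite mulr0.
have := dist_triangle connected_e (V b) x (V a).
rewrite (dist_sym connected_e (V b)) => ?.
have -> : (d (V a) (V b) < j)%N = false by lia.
by rewrite mul0r.
Qed.

(* The paper's [v_j^+] and, up to sign, [v_j^-]: since [J v = 0], the j-th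
   component of [M v] is spanned by these two vectors. *)
Definition vplus j := E j *m (S j *m v).
Definition vminus j := E j *m (S j.+1 *m v).

Lemma dual_idem_ballmx_v i j : i != j -> i.+1 != j -> E i *m (S j *m v) = 0.
Proof.
move=> ne1 ne2; apply/dual_idem_eq0P => a la.
by rewrite ballmx_v_eq0 // la; lia.
Qed.

Lemma ballmx_v j : S j.+1 *m v = vplus j.+1 + vminus j.
Proof.
apply/colP => a; rewrite [RHS]mxE /vplus /vminus !dual_idemE.
have [->|ne1] := eqVneq (l a) j.+1; first by rewrite (gtn_eqF (ltnSn j)) addr0.
have [la|ne2] := eqVneq (l a) j; first by rewrite add0r.
by rewrite addr0 ballmx_v_eq0 //; lia.
Qed.

Lemma vplus1 : vplus 1 = v.
Proof. by rewrite /vplus (ballmx1 C drg) mul1mx. Qed.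

Lemma vminus0 : vminus 0 = 0.
Proof. by rewrite /vminus (ballmx1 C drg) mul1mx -v_level dual_idemM. Qed.

Lemma allones_v : allones C X *m v = 0.
Proof.
apply/colP => a; rewrite !mxE -[RHS]v_sum; apply: eq_bigr => b _.
by rewrite mxE mul1r.
Qed.

Lemma vminus_diameter : vminus D = 0.
Proof. by rewrite /vminus ballmx_diameter allones_v mulmx0. Qed.

Lemma adjmx_ballmx_v j : (j < D)%N ->
  A *m (S j.+1 *m v) = (p j.+1 1 j)%:R *: (S j.+2 *m v) +
    ((p 0 1 1)%:R - (p j 1 j.+1)%:R - (p j.+1 1 j)%:R) *: (S j.+1 *m v) +
    (p j 1 j.+1)%:R *: (S j *m v).
Proof.
by move=> lt_j; rewrite mulmxA (adjmx_ballmx C drg) // !mulmxDl -!scalemxAl.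
Qed.

(** Take level j of the recurrence for A S_(j+2) v: only the image of [vminus j.+1] on the left and
    S_(j+1) v on the right reach it. The factor is b_(j+1). *)
Lemma lowering_vminus j : (j.+1 < D)%N ->
  E j *m (A *m vminus j.+1) = (p j.+1 1 j.+2)%:R *: vminus j.
Proof.
move=> lt_j; have := congr1 (mulmx (E j)) (adjmx_ballmx_v lt_j).
rewrite {1}ballmx_v !mulmxDr adjmx_dual_idem_eq0 // ?add0r; last lia.
move=> ->; rewrite -!scalemxAr -/(vminus j).
by rewrite !dual_idem_ballmx_v ?scaler0 ?add0r //; lia.
Qed.

Lemma raising_vplus j : (j < D)%N ->
  E j.+2 *m (A *m vplus j.+1) = (p j.+1 1 j)%:R *: vplus j.+2.
Proof.
move=> lt_j; have := congr1 (mulmx (E j.+2)) (adjmx_ballmx_v lt_j).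
rewrite {1}ballmx_v !mulmxDr (@adjmx_dual_idem_eq0 _ _ _ _ connected_e j) //
  ?addr0; last lia.
move=> ->; rewrite -!scalemxAr -/(vplus j.+2).
by rewrite !(dual_idem_ballmx_v (i := j.+2)) ?scaler0 ?addr0 //; lia.
Qed.

(** Only S_(i+1) v and S_(i+2) v have a component on level i + 1. Membership in (M; v) thereby
    becomes a two-term recursion on [g]. *)
Lemma dual_idem_bose_mesner_v (g : nat -> C) i : (i < D)%N ->
  E i.+1 *m ((\sum_(j < D.+1) g j *: S j.+1) *m v) =
  g i *: vplus i.+1 + g i.+1 *: vminus i.+1.
Proof.
move=> lt_i; rewrite mulmx_suml mulmx_sumr.
have lt_i0 : (i < D.+1)%N by lia.
rewrite (bigD1 (Ordinal lt_i0)) //= (bigD1 (Ordinal (lt_i : i.+1 < D.+1)%N)) /=;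
  last by rewrite -val_eqE /= gtn_eqF.
rewrite big1 => [|j /andP[]].
  by rewrite addr0 -!scalemxAl -!scalemxAr.
rewrite -!val_eqE /= => ne1 ne2.
by rewrite -scalemxAl -scalemxAr dual_idem_ballmx_v ?scaler0 //; lia.
Qed.

Lemma dual_idem0_bose_mesner_v (g : nat -> C) :
  E 0 *m ((\sum_(j < D.+1) g j *: S j.+1) *m v) = 0.
Proof.
rewrite mulmx_suml mulmx_sumr big1 // => j _; rewrite -scalemxAl -scalemxAr.
case: (posnP j) => [->|j0]; first by rewrite -/(vminus 0) vminus0 scaler0.
by rewrite dual_idem_ballmx_v ?scaler0 //; lia.
Qed.

(* Two neighbours of x are at distance at most 2 and the entries of v sum to
   zero, so only the differences [G 1 - G 2] and [G 0 - G 1] matter. *)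
Lemma inner_ballmx_v (G : nat -> C) i j :
    (forall y z, \sum_w (d y w < j)%:R * (d w z < i)%:R = G (d y z)) ->
  inner (S i *m v) (S j *m v) =
  (G 1%N - G 2) * inner (S 2 *m v) v + (G 0%N - G 1%N) * inner v v.
Proof.
move=> GP; rewrite -inner_mulmx_sym ?(ballmx_tr C drg) ?ballmx_conj //.
rewrite -!innerZl -innerDl !innerE; apply: eq_bigr => a _.
have v0 (b : 'I_#|X|) : l b <> 1%N -> v b 0 = 0.
  by move/eqP; apply: (proj1 (dual_idem_fixP _ _ _ _) v_level).
have [la|/v0->] := pselect (l a = 1%N); last by rewrite conjC0 !mulr0.
congr (_ * _); rewrite mulmxA.
transitivity (\sum_b G (d (V a) (V b)) * v b 0).
  rewrite mxE; apply: eq_bigr => b _; rewrite mxE -GP.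
  congr (_ * _); rewrite -[RHS]sum_enum_val.
  by apply: eq_bigr => c _; rewrite !mxE.
rewrite -[v in X in _ + X]mul1mx -(ballmx1 C drg).
have zero : \sum_b G 2 * v b 0 = 0 by rewrite -mulr_sumr v_sum mulr0.
rewrite -[RHS]addr0 -[X in _ = _ + X]zero !mxE !mulr_sumr -!big_split /=.
apply: eq_bigr => b _; rewrite !mxE.
have [lb|/v0->] := pselect (l b = 1%N); last by rewrite !mulr0 !addr0.
have := dist_triangle connected_e x (V a) (V b).
rewrite (dist_sym connected_e _ x) la lb.
by case: (d _ _) => [|[|[|n]]] //= _; ring.
Qed.

Lemma sum_ball_pairE i j : exists G : nat -> C,
  forall y z, \sum_w (d y w < j)%:R * (d w z < i)%:R = G (d y z).
Proof.
exists (fun h => \sum_(i' < D.+1) \sum_(j' < D.+1)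
  (i' < j)%:R * (j' < i)%:R * (p h i' j')%:R) => y z.
exact: (sum_dist_mul drg (fun n => (n < j)%:R) (fun n => (n < i)%:R)).
Qed.

(** The product equals <S_(j+1) v, S_j v>, as the two vectors share only level j. If G(h) counts the
    w with d(y, w) <= j and d(w, z) < j for d(y, z) = h, the constant is G(1) - G(2), and G(0) =
    G(1) removes the term in <v, v>. *)
Lemma inner_vminus_vplus j : (0 < j < D)%N ->
  exists2 c : C, c != 0 & inner (vminus j) (vplus j) = c * inner (S 2 *m v) v.
Proof.
move=> /andP[j0 lt_j]; have [G GP] := sum_ball_pairE j.+1 j.
have GP' y z : \sum_w (d y w < j.+1)%:R * (d w z < j)%:R = G (d y z).
  rewrite dist_sym // -GP; apply: eq_bigr => w _.
  by rewrite mulrC (dist_sym connected_e z) (dist_sym connected_e y).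
have G_sub y y' z : G (d y z) - G (d y' z) = \sum_w
    ((d y w < j.+1)%:R - (d y' w < j.+1)%:R) * (d w z < j)%:R.
  by rewrite -!GP' -sumrB; apply: eq_bigr => w _; rewrite mulrBl.
(* On a geodesic of length j + 1 from y to w0, take y' and z at distances 1 and 2 from y: w0 is
   counted for the pair y', z but not for y, z. *)
have [y [w0 dyw]] := exists_dist connected_e x (lt_j : j.+1 <= D)%N.
have [z dyz dzw] : exists2 z, d y z = 2 & d z w0 = j.-1.
  by apply: geodesic_split => //; rewrite dyw; lia.
have [y' dyy' dy'z] := geodesic_split connected_e (dyz : d y z = (1 + 1)%N).
have tri := dist_triangle connected_e; have sym := dist_sym connected_e.
exists (G 1%N - G 2).
  apply: lt0r_neq0; rewrite -dyz -dy'z G_sub (bigD1 w0) //= dyw ltnn subr0.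
  have -> : (d w0 z < j)%N by rewrite sym; lia.
  have -> : (d y' w0 < j.+1)%N by have := tri z y' w0; lia.
  rewrite mulr1 ltr_pwDl //; apply: sumr_ge0 => w _.
  have [lt_wz|_] := ltnP (d w z) j; last by rewrite mulr0.
  have -> : (d y' w < j.+1)%N by have := tri z y' w; rewrite (sym z w); lia.
  by rewrite mulr1 subr_ge0 lern1 leq_b1.
(* The ball of radius j - 1 around z lies in the balls of radius j around z and around each of its
   neighbours. *)
have G01 : G 0%N - G 1%N = 0.
  have dzz : d z z = 0%N by apply/eqP; rewrite dist_eq0.
  have := G_sub z y' z; rewrite dzz dy'z => ->; rewrite big1 // => w _.
  have [lt_wz|_] := ltnP (d w z) j; last by rewrite mulr0.
  have -> : (d y' w < j.+1)%N by have := tri z y' w; rewrite (sym z w); lia.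
  have -> : (d z w < j.+1)%N by rewrite sym; lia.
  by rewrite subrr mul0r.
transitivity (inner (S j.+1 *m v) (S j *m v)); last first.
  by rewrite (inner_ballmx_v GP) G01 mul0r addr0.
rewrite [in RHS]ballmx_v /vminus /vplus -inner_dual_idem innerDl.
rewrite [X in _ = X + _]inner_dual_idem.
rewrite (dual_idem_ballmx_v (i := j.+1) (j := j)); try lia.
by rewrite inner0r add0r.
Qed.

(** The squared norm of S_(j+1) v is here (G(0) - G(1)) <v, v>, where G(h) counts the common part of
    two balls of radius j with centres at distance h. Some w0 lies in the ball around z but not in
    that around its neighbour y, so G(0) > G(1). *)
Lemma ballmx_v_neq0 j : (j < D)%N -> v != 0 -> inner (S 2 *m v) v = 0 ->
  S j.+1 *m v != 0.
Proof.
move=> lt_j v0 s0; have [G GP] := sum_ball_pairE j.+1 j.+1.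
have [y [w0 dyw]] := exists_dist connected_e x (lt_j : j.+1 <= D)%N.
have [z dyz dzw] := geodesic_split connected_e (dyw : d y w0 = (1 + j)%N).
have dzz : d z z = 0%N by apply/eqP; rewrite dist_eq0.
have G01 : 0 < G 0%N - G 1%N.
  rewrite -[in G 1%N]dyz -(dzz) -!GP -sumrB (bigD1 w0) //=.
  rewrite (dist_sym connected_e w0) dzw dyw ltnSn ltnn mulr1 mul0r subr0.
  rewrite ltr_pwDl //; apply: sumr_ge0 => w _; rewrite -mulrBl.
  rewrite (dist_sym connected_e w); case: ltnP => _; rewrite ?mulr0 //.
  by rewrite mulr1 subr_ge0 lern1 leq_b1.
apply: contraNneq v0 => Sv0; apply/eqP/inner_eq0.
have /eqP := inner_ballmx_v GP; rewrite Sv0 inner0l s0 mulr0 add0r eq_sym.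
by rewrite mulf_eq0 gt_eqF //= => /eqP.
Qed.

End LocalVector.

(** * Terwilliger modules *)

Section TerwilligerModules.

Variables (C : numClosedFieldType) (X : finType) (e : rel X) (x : X).
Hypothesis connected_e : connected_simple_graph e.

Local Notation D := (diameter e).
Local Notation V a := (@enum_val X (fun _ : X => true) a).
Local Notation l a := (dist e x (V a)).
Local Notation E := (dual_idem C e x).
Local Notation A := (adjmx C e).
Implicit Types (W : {vspace 'cV[C]_#|X|}) (w : 'cV[C]_#|X|).

(** The matrices that preserve W form an algebra, so testing generators suffices. *)
Lemma Tmodule_intro W : (forall w, w \in W -> A *m w \in W) ->
    (forall i w, (i <= D)%N -> w \in W -> E i *m w \in W) ->
  Tmodule e x W.
Proof.
move=> WA WE.
have [||U UP] := @subspace_exists _ _ (fun B : 'M[C]_#|X| =>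
  forall w, w \in W -> B *m w \in W).
- by move=> w _; rewrite mul0mx mem0v.
- move=> c B B' WB WB' w Ww; rewrite mulmxDl -scalemxAl.
  by rewrite memvD ?memvZ ?WB ?WB'.
suff TU : forall B, terwilliger e x B -> B \in U by move=> B w /TU/UP; apply.
move=> B; apply => [|_ [->|[i le_i ->]]]; last 2 first.
- exact/UP.
- by apply/UP => w; apply: WE.
split=> [|M N /UP WM /UP WN]; apply/UP => w Ww; rewrite ?mul1mx //.
by rewrite -mulmxA WM ?WN.
Qed.

Section Stability.

Variable W : {vspace 'cV[C]_#|X|}.
Hypothesis modW : Tmodule e x W.

Lemma Tmodule_adjmx w : w \in W -> A *m w \in W.
Proof. by apply: modW => U _; apply; left. Qed.

Lemma Tmodule_dual_idem i w : (i <= D)%N -> w \in W -> E i *m w \in W.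
Proof. by move=> le_i; apply: modW => U _; apply; right; exists i. Qed.

Lemma Tmodule_bose_mesner B w : bose_mesner e B -> w \in W -> B *m w \in W.
Proof.
by move=> BB; apply: modW => U algU UT; apply: BB => // _ ->; apply: UT; left.
Qed.

End Stability.

(* If w were a nonzero vector killed by the lowering map, then, E*_(j+1) W
   being the line through w, the components of W of index above j would form
   a proper nonzero submodule. *)
Lemma thin_lowering_inj W v j w :
    irreducible_Tmodule e x W -> thin e x W ->
    v \in W -> v != 0 -> E 1 *m v = v -> (0 < j < D)%N ->
    w \in W -> E j.+1 *m w = w -> E j *m (A *m w) = 0 -> w = 0.
Proof.
move=> [modW _ irrW] thinW Wv v0 Ev /andP[j0 lt_j] Ww Ew Aw0.
have [//|w0] := eqVneq w 0.
have [||U UP] := @subspace_exists _ _ (fun u : 'cV[C]_#|X| =>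
  u \in W /\ forall a : 'I_#|X|, (l a <= j)%N -> u a 0 = 0).
- by split=> [|a _]; rewrite ?mem0v ?mxE.
- move=> c u u' [Wu u0] [Wu' u0']; split=> [|a la].
    by rewrite memvD ?memvZ.
  by rewrite !mxE u0 ?u0' // mulr0 addr0.
have [||U0|UW] := irrW U.
- apply: Tmodule_intro => [u|i u le_i] /UP[Wu u0]; apply/UP; split=> [|a la].
  + exact: Tmodule_adjmx.
  + have [c uE] : exists c, E j.+1 *m u = c *: w.
      apply: (@mem_line_of_dim_le1 _ _ (mximg (E j.+1) W)) => //.
      * exact: thinW.
      * by rewrite -Ew mem_mximg.
      * exact: mem_mximg.
    have nb (b : 'I_#|X|) : dist e (V a) (V b) = 1%N -> (l b <= (l a).+1)%N.
      by have := dist_triangle connected_e (V a) x (V b); lia.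
    (* On levels up to j only the level j + 1 part of u contributes to A u: neighbours reach no
       higher, and u vanishes below. *)
    transitivity ((A *m (E j.+1 *m u)) a 0).
      rewrite !mxE; apply: eq_bigr => b _; rewrite dual_idemE mxE.
      case: eqP => [/nb dab|]; rewrite ?mul0r ?mul1r //.
      by case: eqP => // lb; rewrite u0 //; lia.
    rewrite uE -scalemxAr mxE -Ew.
    have [laj|ne] := eqVneq (l a) j.
      by rewrite Ew (proj1 (dual_idem_eq0P _ _ _ _) Aw0) ?mulr0.
    have Aw : E (l a) *m (A *m (E j.+1 *m w)) = 0.
      by apply: adjmx_dual_idem_eq0 => //; lia.
    by rewrite (proj1 (dual_idem_eq0P _ _ _ _) Aw) ?mulr0.
  + exact: Tmodule_dual_idem.
  + by rewrite dual_idemE u0 //; case: eqP.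
- by apply/subvP => u /UP[].
- have : w \in U.
    apply/UP; split=> // a la; rewrite (proj1 (dual_idem_fixP _ _ _ _) Ew) //.
    by lia.
  by rewrite U0 memv0 (negPf w0).
- case/negP: v0; apply/eqP/colP => a; rewrite mxE.
  have : v \in U by rewrite UW.
  move=> /UP[_ v0]; have [la|ne] := eqVneq (l a) 1%N; first by apply: v0; lia.
  exact: (proj1 (dual_idem_fixP _ _ _ _) Ev).
Qed.

End TerwilligerModules.

(** * The space (M; v) *)

Section BoseMesnerVector.

Variables (C : numClosedFieldType) (X : finType) (e : rel X) (x : X).
Variable p : nat -> nat -> nat -> nat.
Hypothesis drg : distance_regular e p.
Hypothesis D_ge3 : (3 <= diameter e)%N.

Local Notation D := (diameter e).
Let connected_e : connected_simple_graph e := proj1 drg.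
Local Notation d y z := (dist e y z).
Local Notation V a := (@enum_val X (fun _ : X => true) a).
Local Notation l a := (dist e x (V a)).
Local Notation E := (dual_idem C e x).
Local Notation A := (adjmx C e).
Local Notation S := (ballmx C e).
Local Notation J := (allones C X).

Lemma ballmx_sum_entry (g : nat -> C) (a b : 'I_#|X|) :
  (\sum_(j < D.+1) g j *: S j.+1) a b =
  \sum_(d (V a) (V b) <= j < D.+1) g j.
Proof.
set h := d (V a) (V b); rewrite summxE.
rewrite (big_nat_widenl _ 0) // [RHS]big_mkcond big_mkord.
apply: eq_bigr => j _; rewrite !mxE ltnS -/h /=.
by case: (h <= j)%N; rewrite ?mulr1 ?mulr0.
Qed.

Lemma exists_dist_ord n : (n <= D)%N ->
  exists a b : 'I_#|X|, d (V a) (V b) = n.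
Proof.
move=> /(exists_dist connected_e x)[y [z <-]].
by exists (enum_rank y); exists (enum_rank z); rewrite !enum_rankK.
Qed.

Lemma adjmx_allones : A *m J = (p 0 1 1)%:R *: J.
Proof.
apply/matrixP => a b; rewrite !mxE mulr1 -(valency_sum C drg (V a)); last lia.
by rewrite -[RHS]sum_enum_val; apply: eq_bigr => c _; rewrite !mxE mulr1.
Qed.

Lemma allones_neq0 : J != 0.
Proof.
apply/eqP => /matrixP/(_ (enum_rank x) (enum_rank x)); rewrite !mxE => /eqP.
by rewrite oner_eq0.
Qed.

Variable v : 'cV[C]_#|X|.
Hypothesis v_level : E 1 *m v = v.
Hypothesis v_sum : \sum_a v a 0 = 0.

Local Notation vp := (vplus e x v).
Local Notation vm := (vminus e x v).

Lemma bm_vec_allones : bm_vec e x v J.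
Proof.
split; last by rewrite allones_v // mem0v.
by rewrite -(ballmx_diameter C e); apply: (bose_mesner_ballmx drg x).
Qed.

Lemma bm_vecZD c B B' : bm_vec e x v B -> bm_vec e x v B' ->
  bm_vec e x v (c *: B + B').
Proof.
move=> [BB Bv] [BB' Bv']; split; first exact: bose_mesnerZD.
by rewrite mulmxDl -scalemxAl memvD ?memvZ.
Qed.

(** The equations constrain g_0, ..., g_(D-1) only; g_D, the coefficient of S_(D+1) = J, is free. *)
Lemma bm_vecE (g : nat -> C) :
  bm_vec e x v (\sum_(j < D.+1) g j *: S j.+1) <->
  (forall i, (i.+1 < D)%N -> g i *: vp i.+1 + g i.+1 *: vm i.+1 = 0).
Proof.
split=> [[_ /mem_mximg_diameterP Bv] i lt_i|eqs].
  by rewrite -(dual_idem_bose_mesner_v drg) ?Bv // ltnW.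
split; first by apply/(bose_mesnerP drg x); exists g.
apply/mem_mximg_diameterP => -[|i] lt_i.
  exact: (dual_idem0_bose_mesner_v drg).
by rewrite (dual_idem_bose_mesner_v drg) ?eqs // ltnW.
Qed.

(* When no [vp j] vanishes, the system of [bm_vecE] is triangular: it
   determines [g i] from [g i.+1]. *)
Lemma bm_vec_scalar (g : nat -> C) :
    (forall j, (0 < j < D)%N -> vp j != 0) ->
    bm_vec e x v (\sum_(j < D.+1) g j *: S j.+1) -> g D.-1 = 0 ->
  \sum_(j < D.+1) g j *: S j.+1 = g D *: J.
Proof.
move=> vp0 /bm_vecE eqs gD.
have g0 n : (n < D)%N -> g (D.-1 - n)%N = 0.
  elim: n => [|n IHn] lt_n; first by rewrite subn0.
  have nE : (D.-1 - n)%N = (D.-1 - n.+1).+1 by lia.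
  have := eqs (D.-1 - n.+1)%N; rewrite -nE IHn ?(ltnW lt_n) // scale0r addr0.
  move=> /(_ _)/eqP; rewrite scaler_eq0 => H.
  by have /orP[/eqP //|] := H ltac:(lia); rewrite (negPf (vp0 _ _)) //; lia.
rewrite big_ord_recr /= ballmx_diameter big1 ?add0r // => j _.
have -> : (j : nat) = (D.-1 - (D.-1 - j))%N by have := ltn_ord j; lia.
by rewrite g0 ?scale0r //; lia.
Qed.

(** As F lies outside C J, its coefficient at index D - 1 is nonzero; subtracting a multiple of F
    from P cancels that coefficient and leaves a multiple of J. *)
Lemma bm_vec_basis F : (forall j, (0 < j < D)%N -> vp j != 0) ->
    bm_vec e x v F -> (forall c, F <> c *: J) ->
  exists2 U : {vspace 'M[C]_#|X|},
    is_subspace (bm_vec e x v) U & basis_of U [:: J; F].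
Proof.
move=> vp0 FF FJ; exists <<[:: J; F]>>%VS; last first.
  rewrite /basis_of eqxx free_cons span_seq1 seq1_free /=; apply/andP; split.
    apply/negP => /vlineP[c JE]; have [c0|c0] := eqVneq c 0.
      by case/negP: allones_neq0; rewrite JE c0 scale0r.
    by apply: (FJ c^-1); rewrite JE scalerK.
  by apply/eqP => F0; apply: (FJ 0); rewrite scale0r.
move=> P; rewrite span_cons span_seq1; split; last first.
  move=> /memv_addP[_ /vlineP[a ->] [_ /vlineP[b ->] ->]].
  apply: bm_vecZD bm_vec_allones _; rewrite -[b *: F]addr0.
  apply: bm_vecZD => //; rewrite -(addNr J) -scaleN1r.
  exact: bm_vecZD bm_vec_allones bm_vec_allones.
move=> PP; have [BP _] := PP; have [BF _] := FF.
have [g gP] := proj1 (bose_mesnerP drg x _) BP.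
have [f fF] := proj1 (bose_mesnerP drg x _) BF.
have f0 : f D.-1 != 0.
  apply/eqP => f0; apply: (FJ (f D)); rewrite fF.
  by apply: bm_vec_scalar => //; rewrite -fF.
set c := g D.-1 / f D.-1.
have PE : - c *: F + P = \sum_(j < D.+1) (- c * f j + g j) *: S j.+1.
  rewrite fF gP scaler_sumr -big_split; apply: eq_bigr => j _ /=.
  by rewrite scalerDl scalerA.
have := bm_vecZD (- c) FF PP; rewrite PE => 
  /(@bm_vec_scalar (fun j => - c * f j + g j) vp0) /=.
rewrite mulNr divfK // addNr -PE => /(_ erefl)/(canRL (addKr _)) ->.
by rewrite scaleNr opprK addrC memv_add // memvZ // memv_line.
Qed.

Lemma bm_vec_exists : (forall j, (0 < j < D)%N -> exists c, vm j = c *: vp j) ->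
  exists2 F, bm_vec e x v F & forall c, F <> c *: J.
Proof.
move=> vm_line.
have /choice[lam lamP] : forall j, exists c, (0 < j < D)%N -> vm j = c *: vp j.
  move=> j; have [/vm_line[c vmE]|_] := boolP (0 < j < D)%N; last by exists 0.
  by exists c.
(* Solves g_i = - lam_(i+1) g_(i+1) downwards from g_(D-1) = 1, the empty product; g_D is set to
   0. *)
pose g j := if j == D then 0 else \prod_(j.+1 <= i < D) - lam i.
exists (\sum_(j < D.+1) g j *: S j.+1).
  apply/bm_vecE => i lt_i; rewrite lamP ?lt_i // scalerA -scalerDl.
  rewrite /g (ltn_eqF lt_i) (ltn_eqF (ltnW lt_i)) [X in X + _]big_ltn //.
  by rewrite mulNr mulrC addNr scale0r.
move=> c /matrixP gc.
(* The entries at distances D - 1 and D are 1 and 0, so the matrix is no multiple of J. *)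
have [a [b dab]] := exists_dist_ord (leqnn D).
have [a' [b' dab']] := exists_dist_ord (leq_pred D).
have := gc a b; have := gc a' b'; rewrite !ballmx_sum_entry !mxE dab dab'.
have DE : D.-1.+1 = D by lia.
rewrite big_ltn ?DE // big_nat1 /g eqxx addr0 big_geq ?DE //.
rewrite (ltn_eqF (_ : D.-1 < D)%N) ?DE // => <- /eqP.
by rewrite eq_sym oner_eq0.
Qed.

End BoseMesnerVector.

(** * Thin modules of endpoint one *)

(* A rational eigenvalue of an integer matrix is an integer, so it cannot be
   [-1 - b / m] with [0 < b < m]: reduce [m' N + (b' + m') I] modulo a prime
   divisor of [m'], where [b' / m'] is the reduced form of [b / m]. *)
Lemma int_eigenvalue_neq (C : numClosedFieldType) n (N : 'M[int]_n)
    (u : 'cV[C]_n) (eta : C) (m b : nat) :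
    u != 0 -> map_mx intr N *m u = eta *: u -> (0 < b < m)%N ->
  m%:R * (1 + eta) <> - b%:R.
Proof.
move=> u0 Nu /andP[b0 lt_bm] etaE.
have g0 : (0 < gcdn m b)%N by rewrite gcdn_gt0 b0 orbT.
have gC : (gcdn m b)%:R != 0 :> C by rewrite pnatr_eq0 -lt0n.
have [m' mE] := dvdnP (dvdn_gcdl m b); have [b' bE] := dvdnP (dvdn_gcdr m b).
have cop : coprime m' b'.
  have := muln_gcdl m' b' (gcdn m b); rewrite -mE -bE -[RHS]mul1n => /eqP.
  by rewrite eqn_pmul2r.
(* Otherwise m would be at most the gcd, hence at most b. *)
have m'_gt1 : (1 < m')%N.
  rewrite ltnNge; apply/negP => le1.
  have : (m <= gcdn m b)%N by rewrite {1}mE -[leqRHS]mul1n leq_mul2r le1 orbT.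
  by have := dvdn_leq b0 (dvdn_gcdr m b); lia.
have eta'E : m'%:R * (1 + eta) + b'%:R = 0.
  apply: (mulfI gC); rewrite mulr0 mulrDr mulrA -!natrM [(_ * m')%N]mulnC.
  by rewrite [(_ * b')%N]mulnC -mE -bE etaE addNr.
pose M : 'M[int]_n := m'%:Z *: N + (b' + m')%:Z%:M.
have Mu : map_mx intr M *m u = 0.
  rewrite map_mxD map_mxZ map_scalar_mx mulmxDl -scalemxAl Nu mul_scalar_mx.
  rewrite scalerA -scalerDl -[RHS](scale0r u) -eta'E; congr (_ *: _).
  by rewrite /= PoszD rmorphD /= !pmulrn; ring.
have detM : \det M = 0.
  have /eqP : \det (map_mx intr M : 'M[C]_n)^T = 0.
    apply/eqP/det0P; exists u^T; first by rewrite -trmx0 (inj_eq trmx_inj).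
    by rewrite -trmx_mul Mu trmx0.
  by rewrite det_tr det_map_mx intr_eq0 => /eqP.
have q_pr : prime (pdiv m') by rewrite pdiv_prime.
set q := pdiv m' in q_pr.
have m'0 : m'%:R = 0 :> 'F_q.
  by apply/eqP; rewrite -(dvdn_pcharf (pchar_Fp q_pr)) pdiv_dvd.
have b'0 : b'%:R != 0 :> 'F_q.
  rewrite -(dvdn_pcharf (pchar_Fp q_pr)); apply/negP => qb'.
  have : (q %| gcdn m' b')%N by rewrite dvdn_gcd pdiv_dvd.
  by rewrite (eqP cop) dvdn1 => /eqP q1; rewrite q1 in q_pr.
have := congr1 (intr : int -> 'F_q) detM; rewrite -det_map_mx.
have -> : map_mx intr M = b'%:R%:M :> 'M['F_q]_n.
  rewrite map_mxD map_mxZ map_scalar_mx /= -!pmulrn m'0 scale0r add0r.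
  by rewrite natrD m'0 addr0.
by rewrite det_scalar rmorph0 => /eqP; rewrite expf_eq0 (negPf b'0) andbF.
Qed.

Section ThinModule.

Variables (C : numClosedFieldType) (X : finType) (e : rel X) (x : X).
Variable p : nat -> nat -> nat -> nat.
Hypothesis drg : distance_regular e p.
Hypothesis D_ge3 : (3 <= diameter e)%N.

Local Notation D := (diameter e).
Let connected_e : connected_simple_graph e := proj1 drg.
Local Notation d y z := (dist e y z).
Local Notation V a := (@enum_val X (fun _ : X => true) a).
Local Notation E := (dual_idem C e x).
Local Notation A := (adjmx C e).
Local Notation S := (ballmx C e).
Local Notation J := (allones C X).
Local Notation k := ((p 0 1 1)%:R : C).
Local Notation b1 := ((p 1 1 2)%:R : C).

Lemma adjmx_dist_function (f : nat -> C) (B : 'M[C]_#|X|) (a b : 'I_#|X|) :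
    (forall a b : 'I_#|X|, B a b = f (d (V a) (V b))) ->
  (A *m B) a b = \sum_w (d (V a) w == 1%N)%:R * f (d w (V b)).
Proof.
move=> Bf; rewrite mxE -[RHS]sum_enum_val; apply: eq_bigr => c _.
by rewrite !mxE Bf.
Qed.

(** Gives the strict bound b_1 < k + 1 under which [int_eigenvalue_neq] is applied. *)
Lemma b1_le_valency : (p 1 1 2 <= p 0 1 1)%N.
Proof.
have [y [z dyz]] := exists_dist connected_e x (ltnW (ltnW D_ge3)).
rewrite -(ler_nat C) -(valency_sum C drg y); last lia.
rewrite -[in p 1]dyz -(sum_sphere_pair C drg); try lia.
apply: ler_sum => w _; case: (d y w == 1%N); rewrite ?mul0r ?mul1r //.
by rewrite lern1 leq_b1.
Qed.

(* The first two steps of the three-term recurrence satisfied by the entries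
   of a pseudo primitive idempotent. *)
Lemma pseudo_space_recurrence (f : nat -> C) (B : 'M[C]_#|X|) theta c :
    (forall a b : 'I_#|X|, B a b = f (d (V a) (V b))) ->
    (A - theta%:M) *m B = c *: distmx C e D ->
  k * f 1%N = theta * f 0%N /\
  k * f 1%N + (f 0%N - f 1%N) + (f 2 - f 1%N) * b1 = theta * f 1%N.
Proof.
move=> Bf AB.
have entry a b : d (V a) (V b) != D ->
    \sum_w (d (V a) w == 1%N)%:R * f (d w (V b)) = theta * f (d (V a) (V b)).
  move=> /negPf ne; have /matrixP/(_ a b) := AB.
  rewrite mulmxBl mul_scalar_mx mxE (adjmx_dist_function _ _ Bf).
  by rewrite !mxE Bf ne mulr0 => /eqP; rewrite subr_eq0 => /eqP.
have dd (y : X) : d y y = 0%N by apply/eqP; rewrite dist_eq0.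
have D0 : (0 < D)%N by lia.
split.
  have := entry (enum_rank x) (enum_rank x); rewrite !dd => <-; last lia.
  rewrite -(valency_sum C drg (V (enum_rank x))) // mulr_suml.
  apply: eq_bigr => w _; case: eqP => [dw|]; rewrite ?mul0r //.
  by rewrite dist_sym // dw.
have [a [b dab]] := exists_dist_ord x drg D0.
have := entry a b; rewrite dab => <-; last lia.
rewrite -(valency_sum C drg (V a)) // -[in p 1]dab -(sum_sphere_pair C drg);
  try lia.
(* Of the k neighbours of [V a], one is [V b] itself and b_1 are at distance 2 from it; the others
   are at distance 1. The corrections to k f(1) are written as sums over w as well. *)
have -> : f 0%N - f 1%N = \sum_w (f 0%N - f 1%N) * (w == V b)%:R.
  rewrite (bigD1 (V b)) //= eqxx mulr1 big1 ?addr0 // => w /negPf->.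
  by rewrite mulr0.
rewrite mulr_suml mulr_sumr -!big_split /=; apply: eq_bigr => w _.
have [dw|ne] := eqVneq (d (V a) w) 1%N; last first.
  have -> : (w == V b) = false.
    by apply: contra_neqF ne => /eqP ->.
  by rewrite !(mul0r, mulr0) !addr0.
have := dist_triangle connected_e (V a) w (V b).
rewrite (dist_sym connected_e w (V a)) dw dab.
rewrite -(dist_eq0 connected_e).
by case: (d w (V b)) => [|[|[|h]]] //= _; ring.
Qed.

Variables (v : 'cV[C]_#|X|) (W : {vspace 'cV[C]_#|X|}).
Hypothesis v_level : E 1 *m v = v.
Hypothesis v_sum : \sum_a v a 0 = 0.
Hypothesis v_neq0 : v != 0.
Hypothesis irrW : irreducible_Tmodule e x W.
Hypothesis thinW : thin e x W.
Hypothesis Wv : v \in W.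

Local Notation vp := (vplus e x v).
Local Notation vm := (vminus e x v).

Let modW : Tmodule e x W. Proof. by case: irrW. Qed.

Lemma local_eigenvalue_exists : exists eta, local_eigenvalue e x W eta.
Proof.
have line u : u \in mximg (E 1) W -> exists c, u = c *: v.
  move=> Wu; apply: (@mem_line_of_dim_le1 _ _ (mximg (E 1) W)) => //.
    by apply: thinW; lia.
  by rewrite -v_level mem_mximg.
have [eta etaE] : exists eta, E 1 *m (A *m v) = eta *: v.
  exact/line/mem_mximg/(Tmodule_adjmx modW).
exists eta => w /line[c ->].
by rewrite -!scalemxAr -!mulmxA v_level etaE !scalerA mulrC.
Qed.

Lemma vplus_mem j : (j <= D)%N -> vp j \in W.
Proof.
move=> le_j; apply: (Tmodule_dual_idem modW) => //.
apply: (Tmodule_bose_mesner modW) => //.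
by apply: (bose_mesner_ballmx drg x); lia.
Qed.

Lemma vminus_mem j : (j <= D)%N -> vm j \in W.
Proof.
move=> le_j; apply: (Tmodule_dual_idem modW) => //.
apply: (Tmodule_bose_mesner modW) => //.
exact: (bose_mesner_ballmx drg x).
Qed.

Variable eta : C.
Hypothesis etaP : local_eigenvalue e x W eta.

Lemma local_adjmx_v : E 1 *m A *m E 1 *m v = eta *: v.
Proof. by apply: etaP; rewrite -v_level mem_mximg. Qed.

Lemma vminus1 : vm 1 = (1 + eta) *: v.
Proof.
have S2 : S 2 = A + 1%:M by rewrite (adjmx_ballmx_diff C drg) subrK.
rewrite /vminus S2 mulmxDl mul1mx mulmxDr v_level scalerDl scale1r addrC.
by congr (_ + _); rewrite -local_adjmx_v -!mulmxA v_level.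
Qed.

Lemma inner_ballmx2_v : inner (S 2 *m v) v = (1 + eta) * inner v v.
Proof.
rewrite -innerZl -vminus1 -[X in inner _ X = _]v_level inner_dual_idemC.
by rewrite v_level.
Qed.

(** Induction upwards: vm_1 = (1 + eta) v = 0, and the injective lowering map sends vm_(j+1) to a
    multiple of vm_j. *)
Lemma vminus_eq0 j : eta = -1 -> (j < D)%N -> vm j = 0.
Proof.
move=> eta1; elim: j => [|j IHj] lt_j; first exact: (vminus0 drg).
case: (posnP j) => [->|j0].
  by rewrite vminus1 eta1 subrr scale0r.
apply: (thin_lowering_inj connected_e irrW thinW Wv v_neq0 v_level (j := j)).
- by rewrite j0 ltnW.
- by rewrite vminus_mem // ltnW.
- exact: dual_idem_idem.
- by rewrite (lowering_vminus drg) // IHj ?scaler0 // ltnW.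
Qed.

(** For eta = -1 the vm_i with i < D vanish, so vp_j = S_j v, which is nonzero. Otherwise <vm_j,
    vp_j> is a nonzero multiple of (1 + eta) <v, v>. *)
Lemma vplus_neq0 j : (0 < j < D)%N -> vp j != 0.
Proof.
move=> /andP[j0 lt_j].
have [eta1|eta1] := eqVneq eta (-1).
  have := @ballmx_v_neq0 _ _ e x p drg v v_level v_sum j.-1.
  rewrite inner_ballmx2_v eta1 subrr mul0r prednK // => H.
  have := H (ltnW lt_j) v_neq0 erefl.
  rewrite -[in S j](prednK j0) (ballmx_v drg v_level v_sum) prednK //.
  by rewrite vminus_eq0 ?addr0 // ; lia.
have [|c c0] := inner_vminus_vplus drg v_level v_sum (j := j); first lia.
rewrite inner_ballmx2_v => vv; apply/eqP => vp0; move/eqP: vv.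
rewrite vp0 inner0r eq_sym !mulf_eq0 (negPf c0) /= addrC addr_eq0 (negPf eta1).
by move=> /eqP/inner_eq0/eqP; rewrite (negPf v_neq0).
Qed.

Lemma vminus_line j : (0 < j < D)%N -> exists c, vm j = c *: vp j.
Proof.
move=> lt_j; apply: (@mem_line_of_dim_le1 _ _ (mximg (E j) W)).
- by apply: thinW; lia.
- exact: vplus_neq0.
- by rewrite -[vp j](dual_idem_idem) mem_mximg // vplus_mem //; lia.
- by rewrite -[vm j](dual_idem_idem) mem_mximg // vminus_mem //; lia.
Qed.

Lemma distmx_diameter_v : distmx C e D *m v = - (S D *m v).
Proof.
by rewrite distmx_ballmx ballmx_diameter mulmxBl allones_v // sub0r.
Qed.

(** A_D v = - S_D v = - vp_D - vm_(D-1), and the last term vanishes. *)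
Lemma bm_vec_distmx : eta = -1 -> bm_vec e x v (distmx C e D).
Proof.
move=> eta1; split.
  rewrite distmx_ballmx addrC -scaleN1r; apply: bose_mesnerZD;
  by apply: (bose_mesner_ballmx drg x).
rewrite distmx_diameter_v memvN; apply/mem_mximg_fullvP.
have DE : D.-1.+1 = D by lia.
rewrite -DE (ballmx_v drg v_level v_sum).
by rewrite vminus_eq0 ?addr0 ?dual_idem_idem //; lia.
Qed.

Lemma bm_vec_pseudo (B : 'M[C]_#|X|) theta c : eta != -1 ->
    theta = -1 - b1 / (1 + eta) -> bose_mesner e B ->
    (A - theta%:M) *m B = c *: distmx C e D ->
  bm_vec e x v B.
Proof.
move=> eta1 thetaE BB AB; split=> //.
have t0 : 1 + eta != 0 by rewrite addrC addr_eq0.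
have [g gB] := proj1 (bose_mesnerP drg x _) BB.
have E0 : E 0 *m (B *m v) = 0 by rewrite gB (dual_idem0_bose_mesner_v drg).
(* E*_1 B v = (g_0 + g_1 (1 + eta)) v, where g_0 and g_1 are the first differences of the entries f
   of B. Multiplied by k b_1, the scalar becomes a multiple of k f(1) - theta f(0) = 0. *)
have E1 : E 1 *m (B *m v) = 0.
  pose f h := \sum_(h <= j < D.+1) g j.
  have [|f1 f2] := @pseudo_space_recurrence f B theta c _ AB.
    by move=> a b; rewrite gB ballmx_sum_entry.
  have f01 : f 0%N - f 1%N = g 0%N by rewrite /f big_ltn // addrK.
  have f12 : f 1%N - f 2 = g 1%N by rewrite /f big_ltn ?addrK //; lia.
  rewrite gB (dual_idem_bose_mesner_v drg) //; last lia.
  rewrite vminus1 (vplus1 drg) // scalerA -scalerDl -f01 -f12.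
  have k0 : k != 0.
    by rewrite pnatr_eq0 -lt0n (b_gt0 drg x) //; lia.
  have b10 : b1 != 0.
    by rewrite pnatr_eq0 -lt0n (b_gt0 drg x) //; lia.
  suff -> : f 0%N - f 1%N + (f 1%N - f 2) * (1 + eta) = 0 by rewrite scale0r.
  apply: (mulfI k0); apply: (mulfI b10); rewrite !mulr0.
  have b1E : b1 = - (theta + 1) * (1 + eta) by rewrite thetaE; field.
  transitivity (k * (b1 * (f 0%N - f 1%N) + b1 * (f 1%N - f 2) * (1 + eta))).
    by ring.
  have -> : b1 * (f 1%N - f 2) = k * f 1%N + (f 0%N - f 1%N) - theta * f 1%N.
    by rewrite -f2; ring.
  rewrite b1E; transitivity (k * (1 + eta) * (k * f 1%N - theta * f 0%N)).
    by ring.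
  by rewrite f1 subrr mulr0.
(* Strong induction on the level, with [E0] and [E1] as base cases; beyond them, the part of B v on
   level i + 2 is shown to be killed by lowering. *)
apply/mem_mximg_diameterP; elim/ltn_ind => -[|[|i]] IH lt_i //.
apply: (thin_lowering_inj connected_e irrW thinW Wv v_neq0 v_level (j := i.+1)).
- by lia.
- apply: (Tmodule_dual_idem modW); first exact: ltnW.
  exact: (Tmodule_bose_mesner modW).
- exact: dual_idem_idem.
(* On level i + 1 < D - 1 the term theta B v vanishes by induction, and A_D v = - S_D v is supported
   on levels D - 1 and D. *)
have EA : E i.+1 *m (A *m (B *m v)) = 0.
  have -> : A *m (B *m v) = theta *: (B *m v) + c *: (distmx C e D *m v).
    rewrite scalemxAl -AB mulmxBl mul_scalar_mx mulmxBl -scalemxAl mulmxA.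
    by rewrite addrC subrK.
  rewrite mulmxDr -!scalemxAr IH //; last exact: ltnW.
  rewrite distmx_diameter_v mulmxN (dual_idem_ballmx_v drg) //; try lia.
  by rewrite oppr0 !scaler0 addr0.
(* Levels of B v below i + 2 vanish by induction and those above are out of reach of level i + 1. *)
rewrite -[RHS]EA [in RHS](sum_dual_idem e x (B *m v)) !mulmx_sumr.
rewrite (bigD1 (Ordinal (ltnW lt_i : i.+2 < D.+1)%N)) //= big1 ?addr0 // => j.
rewrite -val_eqE /= => ne.
have [lt_j|ge_j] := ltnP j i.+2; first by rewrite IH ?mulmx0 //; lia.
by rewrite adjmx_dual_idem_eq0 //; lia.
Qed.

End ThinModule.

(** * From an element of (M; v) outside C J to a thin module *)

Section ModuleOfVector.

Variables (C : numClosedFieldType) (X : finType) (e : rel X) (x : X).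
Variable p : nat -> nat -> nat -> nat.
Hypothesis drg : distance_regular e p.
Hypothesis D_ge3 : (3 <= diameter e)%N.

Local Notation D := (diameter e).
Let connected_e : connected_simple_graph e := proj1 drg.
Local Notation E := (dual_idem C e x).
Local Notation A := (adjmx C e).
Local Notation S := (ballmx C e).
Local Notation J := (allones C X).

Variable v : 'cV[C]_#|X|.
Hypothesis v_level : E 1 *m v = v.
Hypothesis v_sum : \sum_a v a 0 = 0.
Hypothesis v_neq0 : v != 0.

Local Notation vp := (vplus e x v).
Local Notation vm := (vminus e x v).

Lemma vplus_vminus_of_bm_vec F : bm_vec e x v F -> (forall c, F <> c *: J) ->
  forall j, (0 < j < D)%N -> vp j != 0 /\ exists c, vm j = c *: vp j.
Proof.
move=> FF FJ; have [BF _] := FF.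
have [g gF] := proj1 (bose_mesnerP drg x _) BF.
have eqs i : (i.+1 < D)%N -> g i *: vp i.+1 + g i.+1 *: vm i.+1 = 0.
  by move: FF; rewrite gF => /(bm_vecE drg v_level v_sum); apply.
have g_neq0 : ~ (forall i, (i < D)%N -> g i = 0).
  move=> g0; apply: (FJ (g D)); rewrite gF big_ord_recr /= ballmx_diameter.
  by rewrite big1 ?add0r // => i _; rewrite g0 ?scale0r.
(* If <S_2 v, v> = 0, then vp_(i+1) and vm_(i+1) are orthogonal, so each equation splits into g_i
   vp_(i+1) = 0 and g_(i+1) vm_(i+1) = 0. *)
have [s0|s0] := eqVneq (inner (S 2 *m v) v) 0.
  have orth i : (i.+1 < D)%N -> inner (vm i.+1) (vp i.+1) = 0.
    move=> lt_i.
    have [//|c _ ->] := inner_vminus_vplus drg v_level v_sum (j := i.+1).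
    by rewrite s0 mulr0.
  have gvp i : (i.+1 < D)%N -> g i *: vp i.+1 = 0.
    move=> lt_i; have := congr1 (fun u => inner u (vp i.+1)) (eqs i lt_i).
    rewrite /= innerDl !innerZl orth // mulr0 addr0 inner0l => /eqP.
    rewrite mulf_eq0 => /orP[/eqP->|/eqP/inner_eq0->]; first by rewrite scale0r.
    by rewrite scaler0.
  have gvm i : (i < D)%N -> g i *: vm i = 0.
    case: i => [|i] lt_i; first by rewrite (vminus0 drg) // scaler0.
    by have := eqs i lt_i; rewrite gvp // add0r.
  have Sv i : (i < D)%N -> S i.+1 *m v != 0.
    by move=> lt_i; apply: (ballmx_v_neq0 drg v_level).
  (* Both components of g_i S_(i+1) v vanish, while S_(i+1) v does not. *)
  have g0 i : (i.+1 < D)%N -> g i = 0.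
    move=> lt_i; have /eqP : g i *: (S i.+1 *m v) = 0.
      by rewrite (ballmx_v drg v_level v_sum) scalerDr gvp // gvm ?addr0 // ltnW.
    by rewrite scaler_eq0 (negPf (Sv _ (ltnW lt_i))) orbF => /eqP.
  have gD : g D.-1 != 0.
    apply/eqP => gD; apply: g_neq0 => i lt_i.
    have [lt_i1|ge_i] := ltnP i.+1 D; first exact: g0.
    by have -> : i = D.-1 by lia.
  (* A nonzero g_(D-1) forces vm_(D-1) = 0, and lowering, with its nonzero factors b_j, carries this
     down to every vm_j. *)
  have vm0 n : (n < D)%N -> vm (D.-1 - n)%N = 0.
    elim: n => [|n IHn] lt_n.
      have /eqP := gvm D.-1 ltac:(lia).
      by rewrite subn0 scaler_eq0 (negPf gD) => /eqP.
    have nE : (D.-1 - n)%N = (D.-1 - n.+1).+1 by lia.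
    have := @lowering_vminus _ _ e x p drg v v_level v_sum (D.-1 - n.+1).
    rewrite -nE IHn ?(ltnW lt_n) // !mulmx0 => /(_ ltac:(lia))/esym/eqP.
    rewrite scaler_eq0 pnatr_eq0 -leqn0 leqNgt (b_gt0 drg x) /=.
      by move/eqP.
    by lia.
  move=> j /andP[j0 lt_j].
  have vmj i : (i < D)%N -> vm i = 0.
    by move=> lt_i; rewrite -(vm0 (D.-1 - i)%N); [congr vminus|]; lia.
  split; last by exists 0; rewrite scale0r vmj.
  have := Sv j.-1 ltac:(lia).
  by rewrite (ballmx_v drg v_level v_sum) vmj ?addr0 ?prednK //; lia.
(* If <S_2 v, v> is nonzero, no vp_j or vm_j with 0 < j < D vanishes; so consecutive g_i vanish
   together, and hence none does for i < D. *)
have vmvp i : (i.+1 < D)%N -> vm i.+1 != 0 /\ vp i.+1 != 0.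
  move=> lt_i.
  have [//|c c0 H] := inner_vminus_vplus drg v_level v_sum (j := i.+1).
  split; apply/eqP => vE; move: H; rewrite vE ?inner0l ?inner0r => /eqP;
  by rewrite eq_sym mulf_eq0 (negPf c0) (negPf s0).
have g_step i : (i.+1 < D)%N -> (g i == 0) = (g i.+1 == 0).
  move=> lt_i; have [vmn0 vpn0] := vmvp _ lt_i; have := eqs i lt_i.
  have [->|gi] := eqVneq (g i) 0.
    move=> /eqP; rewrite scale0r add0r scaler_eq0 (negPf vmn0) orbF.
    by move=> ->.
  have [->|//] := eqVneq (g i.+1) 0.
  by move=> /eqP; rewrite scale0r addr0 scaler_eq0 (negPf vpn0) (negPf gi).
have g_all i : (i < D)%N -> (g i == 0) = (g 0%N == 0).
  by elim: i => // i IHi lt_i; rewrite -g_step // IHi // ltnW.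
have gn0 i : (i < D)%N -> g i != 0.
  move=> lt_i; rewrite g_all //; apply/negP => g00.
  by apply: g_neq0 => j lt_j; apply/eqP; rewrite g_all.
case=> [|i] //= lt_i; have [_ vpn0] := vmvp _ lt_i; split=> //.
exists (- (g i / g i.+1)).
apply: (scalerI (gn0 _ lt_i)); have := eqs i lt_i.
rewrite addrC => /eqP; rewrite addr_eq0 => /eqP ->.
by rewrite scalerA mulrN mulrC divfK ?gn0 // scaleNr.
Qed.

Lemma thin_module_exists :
    (forall j, (0 < j < D)%N -> vp j != 0 /\ exists c, vm j = c *: vp j) ->
  exists2 W : {vspace 'cV[C]_#|X|}, thin_irreducible_endpoint1 e x W & v \in W.
Proof.
move=> vpm.
(* The module is M v; its level i is spanned by vp_i for i > 0. *)
have [||W WP] := @subspace_exists _ _ (fun w : 'cV[C]_#|X| =>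
  exists2 B, bose_mesner e B & w = B *m v).
- by exists 0; [move=> U _ _; rewrite mem0v | rewrite mul0mx].
- move=> c _ _ [B BB ->] [B' BB' ->]; exists (c *: B + B').
    exact: bose_mesnerZD.
  by rewrite mulmxDl -scalemxAl.
have Sv j : (j <= D.+1)%N -> S j *m v \in W.
  by move=> le_j; apply/WP; exists (S j) => //; apply: (bose_mesner_ballmx drg x).
have Wv : v \in W by have := Sv 1%N; rewrite (ballmx1 C drg) mul1mx; apply.
have vm_line j : (0 < j <= D)%N -> exists c, vm j = c *: vp j.
  move=> /andP[j0 le_j]; have [lt_j|ge_j] := ltnP j D.
    by case: (vpm j) => //; rewrite j0.
  have -> : j = D by lia.
  by exists 0; rewrite vminus_diameter // scale0r.
have Wvp j : (j < D)%N -> vp j.+1 \in W.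
  elim: j => [|j IHj] lt_j; first by rewrite (vplus1 drg).
  have [c vmE] := vm_line j.+1 ltac:(lia).
  have := ballmx_v drg v_level v_sum j.+1 => /(canLR (addrK _)) <-.
  by apply: memvB; [apply: Sv; lia|rewrite vmE memvZ // IHj // ltnW].
have comp i w : w \in W -> (i < D)%N -> exists c, E i.+1 *m w = c *: vp i.+1.
  move=> /WP[B BB ->] lt_i; have [g ->] := proj1 (bose_mesnerP drg x _) BB.
  have [c vmE] := vm_line i.+1 ltac:(lia).
  exists (g i + g i.+1 * c).
  by rewrite (dual_idem_bose_mesner_v drg) // vmE scalerA -scalerDl.
have comp0 w : w \in W -> E 0 *m w = 0.
  move=> /WP[B BB ->]; have [g ->] := proj1 (bose_mesnerP drg x _) BB.
  exact: (dual_idem0_bose_mesner_v drg).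
have modW : Tmodule e x W.
  apply: Tmodule_intro => [w /WP[B BB ->]|[|i] w le_i Ww].
  - apply/WP; exists (A *m B); [exact: bose_mesner_adjmxM|by rewrite mulmxA].
  - by rewrite comp0 // mem0v.
  - by have [c ->] := comp i w Ww le_i; rewrite memvZ // Wvp.
exists W => //; split.
- split=> //.
    by apply/eqP => W0; move: Wv; rewrite W0 memv0 (negPf v_neq0).
  move=> U modU UW; have [->|U0] := eqVneq U 0%VS; [by left|right].
  suff Uv : v \in U.
    apply/eqP; rewrite eqEsubv UW; apply/subvP => w /WP[B BB ->].
    exact: (Tmodule_bose_mesner modU).
  (* Lowering is adjoint to raising, which sends vp_(i+1) to c_(i+1) vp_(i+2); so a nonzero vp_(i+2)
     is not killed, and U is followed down to vp_1 = v. *)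
  have descend i : (i < D)%N -> vp i.+1 != 0 -> vp i.+1 \in U -> v \in U.
    elim: i => [|i IHi] lt_i vpi Uvp; first by rewrite -(vplus1 drg v_level).
    have [c cE] := comp i _ (Tmodule_adjmx modW (Wvp _ lt_i)) (ltnW lt_i).
    have c0 : c != 0.
      have : inner (E i.+1 *m (A *m vp i.+2)) (vp i.+1) != 0.
        rewrite {2}/vplus -inner_dual_idemC -/(vplus e x v i.+1).
        rewrite inner_mulmx_sym ?(adjmx_tr C drg) ?adjmx_conj //.
        rewrite {1}/vplus inner_dual_idem (raising_vplus drg v_level v_sum);
          last exact: ltnW.
        rewrite innerZr conjC_nat mulf_neq0 //.
          by rewrite pnatr_eq0 -lt0n (c_gt0 drg x) // ltnW.
        by apply: contra_neq vpi => /inner_eq0.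
      by apply: contra_neq => c0; rewrite cE c0 scale0r inner0l.
    apply: IHi; first exact: ltnW.
      by have [] := vpm i.+1 ltac:(lia).
    rewrite -(scalerK c0 (vp i.+1)) -cE memvZ //.
    by apply: (Tmodule_dual_idem modU); [lia|exact: (Tmodule_adjmx modU)].
  (* A nonzero vector of U has a nonzero component on some level, and that component is a multiple
     of some vp_(i+1). *)
  have [i [le_i Eu]] : exists i, (i <= D)%N /\ E i *m vpick U != 0.
    apply: contrapT => H; have : vpick U == 0.
      rewrite (sum_dual_idem e x (vpick U)) big1 // => i _; apply/eqP.
      by apply: contrapT => /negP Ei; apply: H; exists i; rewrite -ltnS.
    by rewrite vpick0 (negPf U0).
  have Wu : vpick U \in W by apply: (subvP UW); rewrite memv_pick.
  case: i => [|i] in le_i Eu *; first by rewrite comp0 ?eqxx in Eu.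
  have [c cE] := comp i _ Wu le_i.
  have [c0 vpi] : c != 0 /\ vp i.+1 != 0.
    by apply/andP; move: Eu; rewrite cE scaler_eq0 negb_or.
  apply: (descend i) => //; rewrite -(scalerK c0 (vp i.+1)) -cE memvZ //.
  by apply: (Tmodule_dual_idem modU); rewrite ?memv_pick.
- move=> i le_i; apply: leq_trans (_ : \dim <[vp i]>%VS <= 1)%N; last first.
    by rewrite dim_vline leq_b1.
  apply/dimvS/subvP => _ /memv_imgP[w Ww ->]; rewrite lfunE /=.
  case: i le_i => [|i] le_i; first by rewrite comp0 // mem0v.
  by have [c ->] := comp i w Ww le_i; rewrite memvZ // memv_line.
- split; first lia.
    apply/eqP => E0; have := mem_mximg e x 1 Wv.
    by rewrite E0 v_level memv0 (negPf v_neq0).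
  case=> // _; apply/eqP; rewrite -subv0; apply/subvP => _ /memv_imgP[w Ww ->].
  by rewrite lfunE /= comp0 // mem0v.
Qed.

End ModuleOfVector.

(** * Pseudo primitive idempotents *)

Lemma sphere_vecE (C : numClosedFieldType) (X : finType) (e : rel X) (x : X) i
    (a : 'I_#|X|) :
  sphere_vec C e x i a 0 = (dist e x (enum_val a) == i)%:R.
Proof.
rewrite /sphere_vec summxE big_mkcond (bigD1 (enum_val a)) //= big1.
  by rewrite addr0 mxE enum_valK !eqxx; case: eqP.
move=> y ne; rewrite mxE; case: eqP => // _.
by rewrite -(inj_eq enum_val_inj) enum_rankK eq_sym (negPf ne).
Qed.

Lemma local_vector_sum (C : numClosedFieldType) (X : finType) (e : rel X)
    (x : X) (v : 'cV[C]_#|X|) :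
    dual_idem C e x 1 *m v = v -> inner v (sphere_vec C e x 1) = 0 ->
  \sum_a v a 0 = 0.
Proof.
move=> v_level vs0; rewrite -[RHS]vs0 innerE; apply: eq_bigr => a _.
rewrite sphere_vecE conjC_nat; case: eqVneq => [|la]; first by rewrite mulr1.
by rewrite (proj1 (dual_idem_fixP _ _ _ _) v_level) // mul0r.
Qed.

Section Idempotent.

Variables (C : numClosedFieldType) (X : finType) (e : rel X) (x : X).
Variable p : nat -> nat -> nat -> nat.
Hypothesis drg : distance_regular e p.
Hypothesis D_ge3 : (3 <= diameter e)%N.
Variables (v : 'cV[C]_#|X|) (W : {vspace 'cV[C]_#|X|}) (eta : C).
Hypothesis v_level : dual_idem C e x 1 *m v = v.
Hypothesis v_sum : \sum_a v a 0 = 0.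
Hypothesis v_neq0 : v != 0.
Hypothesis irrW : irreducible_Tmodule e x W.
Hypothesis thinW : thin e x W.
Hypothesis Wv : v \in W.
Hypothesis etaP : local_eigenvalue e x W eta.

Local Notation D := (diameter e).
Local Notation J := (allones C X).

(** Equality would give (k + 1) (1 + eta) = - b_1, although eta is an eigenvalue of an integer
    matrix. *)
Lemma tilde_eta_neq_valency : (p 0 1 1)%:R <> -1 - (p 1 1 2)%:R / (1 + eta).
Proof.
have b1_gt0 : (0 < p 1 1 2)%N by apply: (b_gt0 drg x); lia.
(* As the inverse of 0 is 0 by convention, the case eta = -1 would read k = -1. *)
have [eta1|eta1] := eqVneq (1 + eta) 0.
  rewrite eta1 invr0 mulr0 subr0 => /eqP; rewrite -subr_eq0 opprK natr1.
  by rewrite pnatr_eq0.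
(* An integer form of E*_1 A; on v, which E*_1 fixes, it acts as E*_1 A E*_1. *)
pose N : 'M[int]_#|X| := \matrix_(a, b)
  ((dist e x (enum_val a) == 1%N) &&
   (dist e (enum_val a) (enum_val b) == 1%N))%:R.
have Nv : map_mx intr N *m v = eta *: v.
  rewrite -(local_adjmx_v v_level Wv etaP) -!mulmxA v_level.
  apply/colP => a; rewrite dual_idemE !mxE.
  case: eqP => la; last first.
    by rewrite big1 // => b _; rewrite !mxE (introF eqP la) mul0r.
  by apply: eq_bigr => b _; rewrite !mxE la eqxx /= mulrz_nat.
move=> kE.
apply: (int_eigenvalue_neq (m := (p 0 1 1).+1) (b := p 1 1 2) v_neq0 Nv).
  by rewrite b1_gt0 ltnS; apply: (b1_le_valency C x drg).
by rewrite -natr1 kE; field.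
Qed.

Lemma pseudo_idempotent_bm_vec F :
  pseudo_primitive_idempotent e (tilde (p 1 1 2)%N (Some eta)) F ->
  bm_vec e x v F.
Proof.
rewrite /tilde => -[_]; case: eqVneq => [eta1 [c ->]|eta1 [BF [c AF]]].
  rewrite -[c *: _]addr0 -(addNr J) -scaleN1r; apply: bm_vecZD.
    exact: (bm_vec_distmx drg D_ge3 v_level v_sum v_neq0 irrW thinW Wv etaP).
  by apply: bm_vecZD; apply: (bm_vec_allones x drg).
exact: (bm_vec_pseudo drg D_ge3 v_level v_sum v_neq0 irrW thinW Wv etaP eta1
  erefl BF AF).
Qed.

(** Compare diagonal entries: those of A_D are zero, while (A - eta~) c J = c (k - eta~) J with k
    different from eta~. For eta = -1, F itself is a multiple of A_D. *)
Lemma pseudo_idempotent_neq_allones F :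
    pseudo_primitive_idempotent e (tilde (p 1 1 2)%N (Some eta)) F ->
  forall c, F <> c *: J.
Proof.
move=> [F0 pF] c FE; pose a := enum_rank x.
have DD : (dist e (enum_val a) (enum_val a) == D) = false.
  have [conn _] := drg; have /eqP -> : dist e (enum_val a) (enum_val a) == 0%N.
    by rewrite dist_eq0.
  by lia.
suff c0 : c = 0 by apply: F0; rewrite FE c0 scale0r.
move: pF; rewrite /tilde; case: eqVneq => [_ [c' FE']|eta1 [_ [c' AF]]].
  by have /matrixP/(_ a a) := FE; rewrite FE' !mxE DD mulr0 mulr1.
have /matrixP/(_ a a) := AF; rewrite FE -scalemxAr mulmxBl mul_scalar_mx.
rewrite (adjmx_allones C drg) // -scalerBl scalerA !mxE DD mulr0 mulr1 => /eqP.
rewrite mulf_eq0 subr_eq0 => /orP[/eqP //|/eqP kE].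
by case: tilde_eta_neq_valency.
Qed.

Lemma pseudo_idempotent_basis F :
    pseudo_primitive_idempotent e (tilde (p 1 1 2)%N (Some eta)) F ->
  exists2 U : {vspace 'M[C]_#|X|},
    is_subspace (bm_vec e x v) U & basis_of U [:: J; F].
Proof.
move=> pF; apply: (bm_vec_basis drg D_ge3 v_level v_sum).
- exact: (vplus_neq0 drg D_ge3 v_level v_sum v_neq0 irrW thinW Wv etaP).
- exact: pseudo_idempotent_bm_vec.
- exact: pseudo_idempotent_neq_allones.
Qed.

End Idempotent.

Section Equivalence.

Variables (C : numClosedFieldType) (X : finType) (e : rel X) (x : X).
Variable p : nat -> nat -> nat -> nat.
Hypothesis drg : distance_regular e p.
Hypothesis D_ge3 : (3 <= diameter e)%N.
Variable v : 'cV[C]_#|X|.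
Hypothesis v_level : dual_idem C e x 1 *m v = v.
Hypothesis v_sum : \sum_a v a 0 = 0.
Hypothesis v_neq0 : v != 0.

Lemma thin_module_iff_bm_vec_dim :
  (exists2 W : {vspace 'cV[C]_#|X|},
    thin_irreducible_endpoint1 e x W & v \in W) <->
  (exists2 U : {vspace 'M[C]_#|X|},
    is_subspace (bm_vec e x v) U & (2 <= \dim U)%N).
Proof.
split=> [[W [irrW thinW _] Wv]|[U UP dimU]].
  have [eta etaP] := local_eigenvalue_exists D_ge3 v_level v_neq0 irrW thinW Wv.
  have vp0 := vplus_neq0 drg D_ge3 v_level v_sum v_neq0 irrW thinW Wv etaP.
  have [|F FF FJ] := bm_vec_exists drg D_ge3 v_level v_sum.
    exact: (vminus_line drg D_ge3 v_level v_sum v_neq0 irrW thinW Wv etaP).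
  have [U UP basisU] := bm_vec_basis drg D_ge3 v_level v_sum vp0 FF FJ.
  by exists U => //; rewrite (size_basis (X := [tuple allones C X; F]) basisU).
have [F UF FJ] : exists2 F, F \in U & F \notin <[allones C X]>%VS.
  by apply/subvPn; apply/negP => /dimvS; rewrite dim_vline; case: eqP; lia.
apply: (thin_module_exists drg D_ge3 v_level v_sum v_neq0).
apply: (vplus_vminus_of_bm_vec drg D_ge3 v_level v_sum v_neq0 (F := F)).
  exact/UP.
by move=> c FE; case/negP: FJ; rewrite FE memvZ // memv_line.
Qed.

End Equivalence.


Theorem theorem1p2 (R : realType) (X : finType) (e : rel X)
  (p : nat -> nat -> nat -> nat) (x : X) (v : 'cV[R[i]]_#|X|)
  (hG : distance_regular e p)
  (hD : (3 <= diameter e)%N)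
  (hv0 : v <> 0)
  (hv1 : v \in mximg (dual_idem R[i] e x 1) fullv)
  (hvs : inner v (sphere_vec R[i] e x 1) = 0) :
  ((exists2 W : {vspace 'cV[R[i]]_#|X|},
      thin_irreducible_endpoint1 e x W & v \in W) <->
   (exists2 U : {vspace 'M[R[i]]_#|X|},
      is_subspace (bm_vec e x v) U & (2 <= \dim U)%N)) /\
  (forall (W : {vspace 'cV[R[i]]_#|X|}) (eta : R[i]) (E : 'M[R[i]]_#|X|),
    thin_irreducible_endpoint1 e x W ->
    v \in W ->
    local_eigenvalue e x W eta ->
    pseudo_primitive_idempotent e (tilde (p 1 1 2)%N (Some eta)) E ->
    exists2 U : {vspace 'M[R[i]]_#|X|},
      is_subspace (bm_vec e x v) U & basis_of U [:: allones R[i] X; E]).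
Proof.
have v_level := proj1 (mem_mximg_fullvP _ _ _ _) hv1.
have v_sum := local_vector_sum v_level hvs.
have v_neq0 : v != 0 by apply/eqP.
split; first exact: (thin_module_iff_bm_vec_dim hG hD v_level v_sum v_neq0).
move=> W eta E [irrW thinW _] Wv etaP.
exact: (pseudo_idempotent_basis hG hD v_level v_sum v_neq0 irrW thinW Wv etaP).
Qed.
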